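(* Let $a,b,c,d,x_0,x_1$ be real numbers such that $a,c<0$, $b,d>0$, $x_0>0.55$ and $x_1>1.36$. Then the piecewise system $$\begin{cases}\dot z=(a+ib)(z-i+x_1), & z\in\Sigma_+=\{\Im(z)>1\},\\ \dot z=\dfrac{iz^2}{1+z}, & z\in\Sigma_c=\{|\Im(z)|<1\},\\ \dot z=(c+id)(z+i-x_0), & z\in\Sigma_-=\{\Im(z)<-1\},\end{cases}$$ has a limit cycle.
   Context: Planar piecewise-smooth system ($z=x+iy\in\mathbb C\cong\mathbb R^2$) with discontinuity lines $\Im(z)=\pm1$, on which the dynamics follows Filippov's convention (where both adjacent vector fields cross the line in the same direction, trajectories are obtained by concatenation). A limit cycle is an isolated periodic orbit. *)

(* Defs.v *)
From HB Require Import structures.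
From mathcomp Require Import all_boot all_order all_algebra.
From mathcomp Require Import all_classical all_reals all_analysis.
From mathcomp Require Export complex.
Export numFieldNormedType.Exports.

Set Implicit Arguments.
Unset Strict Implicit.
Unset Printing Implicit Defensive.

Import Order.TTheory GRing.Theory Num.Theory.

Local Open Scope classical_set_scope.
Local Open Scope ring_scope.
Local Open Scope complex_scope.

(* The R-valued parts of z : R[i], not the R[i]-valued ones of ssrnum. *)
Local Notation Re := complex.Re.
Local Notation Im := complex.Im.

(* A finite family of non-overlapping subintervals of [a, b] is given by the
   list of the pairs of end points of its members, from left to right. *)
Definition nonoverlapping {R : realType} (a b : R) (s : seq (R * R)) : bool :=
  all (fun p => [&& a <= p.1, p.1 <= p.2 & p.2 <= b]) s &&
  pairwise (fun p q => p.2 <= q.1) s.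

Definition absolutely_continuous {R : realType} (a b : R) (f : R -> R) : Prop :=
  forall e : R, 0 < e -> exists2 d : R, 0 < d &
    forall s : seq (R * R), nonoverlapping a b s ->
      \sum_(p <- s) (p.2 - p.1) < d ->
      \sum_(p <- s) `|f p.2 - f p.1| < e.

Definition locally_absolutely_continuous {R : realType} (f : R -> R) : Prop :=
  forall a b : R, absolutely_continuous a b f.

Definition segment {R : realType} (v w : R[i]) : set R[i] :=
  [set u | exists2 l : R, 0 <= l <= 1 & u = l%:C * v + (1 - l)%:C * w].

(* Filippov's set-valued extension of the piecewise field given by Xp on
   Im z > 1, Xc on |Im z| < 1 and Xm on Im z < -1: on a discontinuity line it
   is the convex hull of the values of the two adjacent fields (crossing,
   sliding and escaping motions are all solutions of the inclusion). *)
Definition filippov {R : realType} (Xp Xc Xm : R[i] -> R[i]) (z : R[i]) :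
    set R[i] :=
  [set v | [\/ 1 < Im z /\ v = Xp z,
               `|Im z| < 1 /\ v = Xc z |
               Im z < -1 /\ v = Xm z]
        \/ (Im z = 1 /\ segment (Xp z) (Xc z) v)
        \/ (Im z = -1 /\ segment (Xc z) (Xm z) v)].

Definition has_velocity {R : realType} (g : R -> R[i]) (t : R) (v : R[i]) :
    Prop :=
  is_derive t (1 : R) (fun s => Re (g s)) (Re v) /\
  is_derive t (1 : R) (fun s => Im (g s)) (Im v).

(* Solutions of the differential inclusion z' \in F z in the phase space D.
   That the whole curve lies in D is not implied by the inclusion, which is
   only required almost everywhere: an absolutely continuous curve may run
   through a pole of the field. *)
Definition solution {R : realType} (D : set R[i]) (F : R[i] -> set R[i])
    (g : R -> R[i]) : Prop :=
  [/\ forall t, D (g t),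
      locally_absolutely_continuous (fun t => Re (g t)),
      locally_absolutely_continuous (fun t => Im (g t)) &
      {ae @lebesgue_measure R, forall t, exists2 v, has_velocity g t v & F (g t) v}].

Definition periodic_orbit {R : realType} (D : set R[i])
    (F : R[i] -> set R[i]) (G : set R[i]) : Prop :=
  exists g : R -> R[i],
    [/\ solution D F g,
        exists2 T : R, 0 < T & forall t, g (t + T) = g t,
        exists t s, g t <> g s &
        G = range g].

(* Open for the topology of the plane, R[i] being identified with R * R. *)
Definition open_plane {R : realType} (U : set R[i]) : Prop :=
  open [set p : R * R | U (p.1 +i* p.2)].

Definition limit_cycle {R : realType} (D : set R[i]) (F : R[i] -> set R[i])
    (G : set R[i]) : Prop :=
  periodic_orbit D F G /\
  exists U : set R[i], [/\ open_plane U, G `<=` U &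
    forall G', periodic_orbit D F G' -> G' `&` U !=set0 -> G' = G].

(* Main.v *)
(** The central field has the first integral [ln |z| - Re (1 / z)], which takes the
    same value at [x + i] and at [x - i]; the two outer fields are linear foci on the
    lines [Im z = 1] and [Im z = -1]. The conditions on [x0] and [x1] make the central
    flow cross the strip upwards, from [x - i] to [x + i], for every [x > x0], and
    downwards, from [x + i] to [x - i], for every [x < - x1]. Composing the two passages
    with the two half turns of the foci gives an affine return map on the half-line
    [x > x0] with ratio in ]0, 1[, hence a unique cycle that crosses the lines.
    A Filippov solution is only absolutely continuous, but along this cycle the lines
    are crossed transversally, so that its future is unique: in the strip it stays on a
    level of the first integral, and outside it is the explicit spiral. Hence a periodic
    solution that meets the basin of the cycle hits the section infinitely often; by
    compactness it contains the fixed point of the return map, and so it is the cycle.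
    The right half turn and, in the plane rotated by [z |-> - z], the left half turn are
    two instances of the same situation, distinguished by a sign [eps]. *)
Require Import Defs.
From mathcomp Require Import all_boot all_order all_algebra.
From mathcomp Require Import all_classical all_reals all_analysis complex.
From mathcomp Require Import measurable_realfun ring lra.
Import Order.TTheory GRing.Theory Num.Theory.
Local Open Scope classical_set_scope.
Local Open Scope ring_scope.
Local Open Scope complex_scope.

Set Implicit Arguments.
Unset Strict Implicit.
Unset Printing Implicit Defensive.

(** * Real functions and absolute continuity *)

Section RealCalculus.
Context {R : realType}.
Implicit Types (f g h : R -> R) (a b c t : R).

(** Uniqueness fails for Filippov solutions in the whole plane: on [Im z = -1] just left of [x0] the
    central field points up and the lower one down, so a solution may linger there and escape to
    either side. Isolation of the cycle has to cope with all these solutions. It therefore rests on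
    forward statements only, made where both adjacent fields cross a line in the same direction;
    periodicity then turns the future of one point into the whole orbit. The mechanism in the strip
    is that the derivative of the first integral in [x] has the sign of the vertical velocity. Where
    the flow rises, level sets are graphs over the height, and a level above that of the threshold
    point [k' + i] cannot meet the barrier [x = e]. The constants come from there. The central field
    is tangent to the lines [Im z = 1] and [Im z = -1] at the positive root of [x^3 + x^2 + x = 1],
    about 0.5437, just below 0.55. The level through the pole -1 meets these lines at an abscissa
    whose opposite is just below 1.36. The periodic solution is built explicitly: a level curve run
    through with a height obtained by separation of variables, followed by a spiral. *)

Lemma continuous_dist f t e : {for t, continuous f} -> 0 < e ->
  exists2 d, 0 < d & forall s, `|s - t| < d -> `|f s - f t| < e.
Proof.
move=> /cvgrPdist_lt cf e0; have /nbhs_ballP[d d0 dP] := cf _ e0.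
exists d => // s st; rewrite distrC; apply: dP.
by rewrite /ball /= distrC.
Qed.

Lemma continuous_gt0 f t : {for t, continuous f} -> 0 < f t ->
  exists2 d, 0 < d & forall s, `|s - t| < d -> 0 < f s.
Proof.
move=> cf ft0; have [d d0 dP] := continuous_dist cf ft0.
by exists d => // s /dP; rewrite ltr_distl subrr => /andP[].
Qed.

Lemma is_derive_dist f t v e : is_derive t 1 f v -> 0 < e ->
  exists2 d, 0 < d & forall s, `|s - t| < d ->
    `|f s - f t - v * (s - t)| <= e * `|s - t|.
Proof.
move=> /is_derive1_caratheodory[g [fE cg <-]] e0.
have [d d0 dP] := continuous_dist cg e0.
exists d => // s /dP gs; rewrite fE -mulrBl normrM ler_wpM2r//.
exact: ltW.
Qed.

Lemma is_derive_continuous f t v : is_derive t 1 f v -> {for t, continuous f}.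
Proof. by case=> /derivable1_diffP/differentiable_continuous. Qed.

(** A supremum argument. The step goes from [s] to [t] across [c] because a derivative at [c]
    controls increments only between points on its two sides. *)
Lemma real_induction (P : R -> Prop) a b : a <= b -> P a ->
  (forall c, a <= c <= b -> exists2 d, 0 < d & forall s t,
     a <= s <= c -> c <= t <= b -> c - d < s -> t < c + d -> P s -> P t) ->
  P b.
Proof.
move=> ab Pa step; pose A := [set t | a <= t <= b /\ P t].
have Aa : A a by split; rewrite ?lexx.
have ubA : ubound A b by move=> t [/andP[]].
have supA : has_sup A by split; [exists a|exists b].
have cab : a <= sup A <= b.
  apply/andP; split; first by apply: ub_le_sup => //; exists b.
  by apply: ge_sup => //; exists a.
have [d d0 dP] := step _ cab.
have [s [/andP[as_ sb] Ps] ls] := sup_adherent d0 supA.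
have ss : s <= sup A by apply: ub_le_sup; [exists b|split => //; apply/andP].
have cP t : sup A <= t <= b -> t < sup A + d -> P t.
  by move=> tb td; apply: (dP s t) => //; apply/andP.
have [lt|ge] := ltP (sup A) b; last first.
  by apply: cP; [case/andP: cab => _ ->; rewrite lexx|rewrite (le_lt_trans ge)// ltrDl].
pose t := Num.min b (sup A + d / 2).
have tsup : sup A < t by rewrite lt_min lt ltrDl divr_gt0.
have tb : t <= b by rewrite ge_min lexx.
have At : A t.
  split; first by rewrite tb andbT; case/andP: cab => /le_trans + _; apply; exact: ltW.
  apply: cP; first by rewrite tb (ltW tsup).
  by rewrite gt_min ltrD2l ltr_pdivrMr ?ltr_pMr ?ltr1n// orbT.
by have := ub_le_sup (ex_intro _ b ubA) At; rewrite leNgt tsup.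
Qed.

End RealCalculus.

(** * Closure properties of absolute continuity *)

Section AbsolutelyContinuous.
Context {R : realType}.
Implicit Types (f g h : R -> R) (a b c t : R).

(** One domination criterion that serves for sums, for squares on bounded ranges and for a Lipschitz
    function of two absolutely continuous ones, such as the first integral along a trajectory. *)
Lemma absolutely_continuous_le (K : R) f g h a b : 0 <= K ->
  (forall s t, a <= s -> s <= t -> t <= b ->
     `|h t - h s| <= K * (`|f t - f s| + `|g t - g s|)) ->
  absolutely_continuous a b f -> absolutely_continuous a b g ->
  absolutely_continuous a b h.
Proof.
move=> K0 hK acf acg e e0.
have e1 : 0 < e / (2 * (K + 1)) by rewrite divr_gt0// mulr_gt0// ltr_wpDl.
have [d1 d10 d1P] := acf _ e1; have [d2 d20 d2P] := acg _ e1.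
exists (Num.min d1 d2); first by rewrite lt_min d10.
move=> s ns; rewrite lt_min => /andP[s1 s2].
have {}d1P := d1P _ ns s1; have {}d2P := d2P _ ns s2.
apply: (@le_lt_trans _ _ (K * (\sum_(p <- s) `|f p.2 - f p.1| +
  \sum_(p <- s) `|g p.2 - g p.1|))).
  rewrite -big_split mulr_sumr big_seq [leRHS]big_seq ler_sum// => p ps.
  by move: ns => /andP[/allP/(_ _ ps)/and3P[? ? ?] _]; apply: hK.
apply: (@le_lt_trans _ _ (K * (2 * (e / (2 * (K + 1)))))).
  by rewrite ler_wpM2l//; lra.
have -> : K * (2 * (e / (2 * (K + 1)))) = e * (K / (K + 1)).
  by field; lra.
by rewrite gtr_pMr// ltr_pdivrMr; lra.
Qed.

Lemma absolutely_continuous_lipschitz (K : R) h a b : 0 <= K ->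
  (forall s t, a <= s -> s <= t -> t <= b -> `|h t - h s| <= K * (t - s)) ->
  absolutely_continuous a b h.
Proof.
move=> K0 hK e e0; exists (e / (K + 1)); first by rewrite divr_gt0// ltr_wpDl.
move=> s /andP[/allP ns _] sd.
apply: (@le_lt_trans _ _ (K * \sum_(p <- s) (p.2 - p.1))).
  rewrite mulr_sumr big_seq [leRHS]big_seq ler_sum// => p /ns/and3P[? ? ?].
  exact: hK.
move: sd; rewrite ltr_pdivlMr; last lra.
have : 0 <= \sum_(p <- s) (p.2 - p.1).
  by rewrite big_seq sumr_ge0// => p /ns/and3P[_ ? _]; rewrite subr_ge0.
nra.
Qed.

Lemma absolutely_continuousN f a b :
  absolutely_continuous a b f -> absolutely_continuous a b (fun t => - f t).
Proof.
move=> acf; apply: (@absolutely_continuous_le 1 f f) => // s t _ _ _.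
by rewrite -opprD normrN mul1r lerDl.
Qed.

Lemma locally_ac_continuous f : locally_absolutely_continuous f -> continuous f.
Proof.
move=> acf t; apply/cvgrPdist_lt => e e0.
have [d d0 dP] := acf (t - 1) (t + 1) _ e0.
apply/nbhs_ballP; exists (Num.min d 1); first by rewrite /= lt_min d0 ltr01.
move=> s; rewrite /ball /= lt_min => /andP[sd s1].
have [st|ts] := leP s t.
  have := dP [:: (s, t)]; rewrite /nonoverlapping /= !big_seq1/=; apply.
    by move: s1; rewrite andbT andbT ltr_distl; lra.
  by rewrite -(ger0_norm (x := t - s)) ?subr_ge0.
have := dP [:: (t, s)]; rewrite /nonoverlapping /= !big_seq1/= distrC; apply.
  by move: s1; rewrite andbT andbT ltr_distl; lra.
by rewrite -(ger0_norm (x := s - t)) ?subr_ge0 ?(ltW ts)// distrC.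
Qed.

End AbsolutelyContinuous.

(** * Monotonicity from the sign of an almost everywhere derivative *)

Section AbsolutelyContinuousMonotone.
Context {R : realType}.
Implicit Types (f g h : R -> R) (a b c t : R).
Local Notation mu := (@lebesgue_measure R).

Lemma ae_lebesgueS (P Q : R -> Prop) : (forall t, P t -> Q t) ->
  {ae mu, forall t, P t} -> {ae mu, forall t, Q t}.
Proof.
by move=> PQ; apply: filterS => //; exact: (ae_filter_ringOfSetsType mu).
Qed.

Lemma lebesgue_measureS (A B : set R) : measurable A -> measurable B -> A `<=` B ->
  (mu A <= mu B)%E.
Proof. by move=> mA mB; have /(_ A B) := le_measure mu; rewrite !inE; apply. Qed.

Lemma lebesgue_measureU2 (A B : set R) : measurable A -> measurable B ->
  (mu (A `|` B) <= mu A + mu B)%E.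
Proof. by move=> mA mB; have /(_ A B) := measureU2 mu; apply. Qed.

Lemma lebesgue_measureU (A B : set R) : measurable A -> measurable B ->
  A `&` B = set0 -> mu (A `|` B) = (mu A + mu B)%E.
Proof. by move=> mA mB; have /(_ A B) := measureU mu; apply. Qed.

Lemma lebesgue_measure_oc (a b : R) : a <= b -> mu `]a, b] = (b - a)%:E.
Proof.
move=> ab; have := lebesgue_measure_itv `]a, b]; rewrite /= => ->.
rewrite lte_fin; case: ltP => //= ba.
by rewrite (_ : b = a) ?subrr//; apply/eqP; rewrite eq_le ab ba.
Qed.

Lemma open_cover_negligible (N : set R) (d : R) : mu.-negligible N -> 0 < d ->
  exists O : set R, [/\ open O, N `<=` O & (mu O < d%:E)%E].
Proof.
move=> [M [mM M0 NM]] d0.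
have muM : (mu M < +oo)%E by rewrite M0.
have [ O [oO MO Od]] := lebesgue_regularity_outer mM muM d0.
exists O; split => //; first exact: subset_trans MO.
have mO := open_measurable oO.
have mD : measurable (O `\` M) by exact: measurableD.
have /le_lt_trans : (mu O <= mu (O `\` M) + mu M)%E.
  apply: le_trans (lebesgue_measureU2 mD mM); apply: lebesgue_measureS => //.
    exact: measurableU.
  by move=> x Ox; have [Mx|Mx] := pselect (M x); [right|left].
by apply; rewrite M0 adde0.
Qed.

(* Each point either has a good derivative, or lies in a small open set O; the
   intervals tagged at points of O contribute little by absolute continuity. *)
Lemma ae_derive_ge0_le f a b : a <= b -> absolutely_continuous a b f ->
  {ae mu, forall t, a < t < b -> exists2 v, is_derive t 1 f v & 0 <= v} ->
  f a <= f b.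
Proof.
move=> ab acf aef; suff key e : 0 < e -> f a - f b <= e * (b - a) + e.
  rewrite -subr_le0; apply/ler_addgt0Pr => e e0; rewrite add0r.
  have ba1 : 0 < b - a + 1 by rewrite ltr_wpDl ?subr_ge0.
  have /key : 0 < e / (b - a + 1) by rewrite divr_gt0.
  by rewrite -[X in _ <= _ + X]mulr1 -mulrDr divfK// gt_eqF.
move=> e0; have [d d0 dP] := acf _ e0.
pose N := ~` [set t | a < t < b -> exists2 v, is_derive t 1 f v & 0 <= v]
  `|` ([set a] `|` [set b]).
have [|O [oO NO Od]] := @open_cover_negligible N _ _ d0.
  apply: negligibleU => //; apply: negligibleU; apply/negligibleP => //;
  exact: lebesgue_measure_set1.
have mO t : measurable (O `&` `[a, t]).
  by apply: measurableI => //; exact: open_measurable.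
(* The family [s] collects the intervals tagged in [O]. Its total length is charged to the measure
   of [O], and its contribution to the decrease of [f] stays explicit until absolute continuity
   absorbs it at [b]. *)
pose P t := exists s : seq (R * R), [/\ nonoverlapping a t s,
  ((\sum_(p <- s) (p.2 - p.1))%:E <= mu (O `&` `[a, t]))%E &
  f a - f t <= e * (t - a) + \sum_(p <- s) `|f p.2 - f p.1|].
suff [s [ns sO fs]] : P b.
  apply: (le_trans fs); rewrite lerD2l ltW//; apply: dP => //.
  rewrite -lte_fin; apply: le_lt_trans sO _; apply: le_lt_trans Od.
  by apply: lebesgue_measureS => //; exact: open_measurable.
apply: (real_induction ab).
  by exists [::]; rewrite /nonoverlapping !big_nil !subrr mulr0 addr0.
move=> c /andP[ac cb]; have [Oc|Oc] := pselect (O c).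
  have /nbhs_ballP[r /= r0 rO] : nbhs c O by apply: open_nbhs_nbhs.
  exists r => // s t /andP[as_ sc] /andP[ct tb] crs tcr [l [/andP[/allP al pl] lO fl]].
  have st := le_trans sc ct.
  exists (rcons l (s, t)); split.
  - rewrite /nonoverlapping all_rcons pairwise_rcons pl/= as_ st lexx/= andbT.
    by apply/andP; split; apply/allP => p /al/and3P[ap pp ps] //=;
      rewrite ap pp (le_trans ps).
  - rewrite big_rcons/= EFinD.
    have st1 : `]s, t] `<=` O `&` `[a, t].
      move=> x /=; rewrite in_itv/= => /andP[sx xt]; split.
        by apply: rO; rewrite /ball/= ltr_distlC; lra.
      by rewrite in_itv/= xt andbT (le_trans as_)// ltW.
    have st2 : O `&` `[a, s] `<=` O `&` `[a, t].
      move=> x [Ox]/=; rewrite in_itv/= => /andP[ax xs]; split => //.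
      by rewrite in_itv/= ax (le_trans xs).
    apply: (@le_trans _ _ (mu (`]s, t] `|` (O `&` `[a, s])))); last first.
      by apply: lebesgue_measureS; [exact: measurableU|exact: mO|rewrite subUset].
    have -> : mu (`]s, t] `|` (O `&` `[a, s])) =
        ((t - s)%:E + mu (O `&` `[a, s]))%E.
      rewrite -(lebesgue_measure_oc st); apply: lebesgue_measureU => //.
      rewrite -subset0 => x [/=]; rewrite !in_itv/= => /andP[sx _] [_ /andP[_ xs]].
      by move: (lt_le_trans sx xs); rewrite ltxx.
    by rewrite addeC leeD.
  - rewrite big_rcons/=; have := ler_norm (f s - f t).
    rewrite distrC; nra.
have nN : ~ N c by move=> /NO.
have [|v dv v0] : a < c < b -> exists2 v, is_derive c 1 f v & 0 <= v.
- by apply: contrapT => h; apply: nN; left.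
- rewrite !lt_neqAle ac cb !andbT.
  apply/andP; split; apply/eqP => h; apply: nN; right; [left|right]; rewrite /= h //.
have [r r0 rP] := is_derive_dist dv e0.
exists r => // s t /andP[as_ sc] /andP[ct tb] crs tcr [l [/andP[/allP al pl] lO fl]].
have st := le_trans sc ct.
exists l; split.
- rewrite /nonoverlapping pl andbT; apply/allP => p /al/and3P[ap pp ps] /=.
  by rewrite ap pp (le_trans ps).
- apply: le_trans lO _; apply: lebesgue_measureS => //.
  move=> x [Ox]/=; rewrite in_itv/= => /andP[ax xs]; split => //.
  by rewrite in_itv/= ax (le_trans xs).
- have := rP s; rewrite (ler0_norm (x := s - c)) ?subr_le0// => sP.
  have /sP : - (s - c) < r by lra.
  have := rP t; rewrite (ger0_norm (x := t - c)) ?subr_ge0// => tP.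
  have /tP : t - c < r by lra.
  rewrite !ler_norml => /andP[? _] /andP[_ ?].
  have := mulr_ge0 v0 (y := t - c); rewrite subr_ge0 => /(_ ct) ?.
  have := mulr_ge0 v0 (y := c - s); rewrite subr_ge0 => /(_ sc) ?.
  nra.
Qed.

Lemma ae_filterT (P : R -> Prop) : {ae mu, forall t, P t} ->
  forall a b, a < b -> exists2 t, a < t < b & P t.
Proof.
move=> [N [mN N0 PN]] a b ab; apply: contrapT => h.
have sub : `]a, b[ `<=` N.
  by move=> t /=; rewrite in_itv/= => tab; apply: PN => /= Pt; apply: h; exists t.
have : (mu `]a, b[ <= mu N)%E by exact: lebesgue_measureS.
rewrite N0; have := lebesgue_measure_itv `]a, b[; rewrite /= => ->.
by rewrite lte_fin ab -EFinB lee_fin leNgt subr_gt0 ab.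
Qed.

Lemma ae_derive_ge_le m f a b : a <= b -> absolutely_continuous a b f ->
  {ae mu, forall t, a < t < b -> exists2 v, is_derive t 1 f v & m <= v} ->
  m * (b - a) <= f b - f a.
Proof.
move=> ab acf aef.
suff : f a - m * a <= f b - m * b by lra.
apply: (@ae_derive_ge0_le (fun t => f t - m * t)) => //.
  apply: (@absolutely_continuous_le _ 1 f ( *%R m)) => //.
    move=> s t _ _ _; rewrite mul1r.
    have -> : f t - m * t - (f s - m * s) = (f t - f s) - (m * t - m * s) by lra.
    exact: ler_normB.
  apply: (@absolutely_continuous_lipschitz _ `|m|) => // s t _ st _.
  by rewrite -mulrBr normrM (ger0_norm (x := t - s)) ?subr_ge0.
apply: ae_lebesgueS aef => t + tab => /(_ tab)[v dv mv].
exists (v - m); last by rewrite subr_ge0.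
apply: is_deriveB; rewrite -[X in is_derive _ _ _ X]mulr1.
by apply: is_deriveZ.
Qed.

Lemma ae_derive_eq0_cst f a b : a <= b -> absolutely_continuous a b f ->
  {ae mu, forall t, a < t < b -> is_derive t 1 f 0} ->
  f b = f a.
Proof.
move=> ab acf aef; apply/eqP; rewrite eq_le; apply/andP; split.
  rewrite -lerN2; apply: (@ae_derive_ge0_le (fun t => - f t)) => //.
    exact: absolutely_continuousN.
  apply: ae_lebesgueS aef => t + tab => /(_ tab) dv; exists 0 => //.
  by rewrite -oppr0; apply: is_deriveN.
apply: ae_derive_ge0_le => //.
by apply: ae_lebesgueS aef => t + tab => /(_ tab) dv; exists 0.
Qed.

(** Monotonicity on every subinterval reduces strictness to excluding a constant [f], and a constant
    contradicts the positive derivative at any single good point. *)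
Lemma ae_derive_gt0_lt f a b : a < b -> absolutely_continuous a b f ->
  {ae mu, forall t, a < t < b -> exists2 v, is_derive t 1 f v & 0 < v} ->
  f a < f b.
Proof.
have acS c d g u v : absolutely_continuous c d g -> c <= u -> v <= d ->
    absolutely_continuous u v g.
  move=> acg cu vd e /acg[r r0 rP]; exists r => // s /andP[/allP as_ ps] sr.
  apply: rP => //; rewrite /nonoverlapping ps andbT.
  apply/allP => p /as_/and3P[up pp pv] /=.
  by rewrite pp (le_trans cu)//= (le_trans pv).
move=> ab acf aef.
have mono u v : a <= u -> u <= v -> v <= b -> f u <= f v.
  move=> au uv vb; apply: ae_derive_ge0_le => //; first exact: acS acf _ _.
  apply: ae_lebesgueS aef => t + /andP[ut tv] => /(_ _)[|w ? ?]; last by exists w => //; lra.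
  by rewrite (le_lt_trans au)// (lt_le_trans tv).
rewrite lt_neqAle mono// ?ltW// andbT; apply/eqP => fab.
have [t tab] := ae_filterT aef ab => /(_ tab)[v dv v0].
have /andP[at_ tb] := tab.
have v20 : 0 < v / 2 by lra.
have [d d0 dP] := is_derive_dist dv v20.
pose s := Num.min b (t + d / 2).
have ts : t < s by rewrite lt_min tb ltrDl divr_gt0.
have sd : s <= t + d / 2 by rewrite ge_min lexx orbT.
have sb : s <= b by rewrite ge_min lexx.
have := dP s; rewrite (gtr0_norm (x := s - t)) ?subr_gt0// => /(_ _)/wrap[|]; first lra.
have -> : f s = f t.
  have := mono t s (ltW at_) (ltW ts) sb.
  have := mono a t (lexx a) (ltW at_) (ltW tb).
  have := mono s b (le_trans (ltW at_) (ltW ts)) sb (lexx b).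
  rewrite fab => h1 h2 h3; apply/eqP; rewrite eq_le h3 andbT.
  exact: le_trans h1 h2.
rewrite ler_norml; nra.
Qed.

End AbsolutelyContinuousMonotone.

(** * Linear foci *)

Section PointwiseDerivatives.
Context {R : realType}.
Implicit Types (f g : R -> R) (t c v : R).

Lemma is_derive1_cst c t : is_derive t (1 : R) (fun=> c) 0.
Proof. exact: is_derive_cst. Qed.

Lemma is_derive1_id t : is_derive t (1 : R) (fun s => s) 1.
Proof. exact: is_derive_id. Qed.

Lemma is_derive1D f g t df dg : is_derive t 1 f df -> is_derive t 1 g dg ->
  is_derive t 1 (fun s => f s + g s) (df + dg).
Proof. exact: is_deriveD. Qed.

Lemma is_derive1N f t df : is_derive t 1 f df ->
  is_derive t 1 (fun s => - f s) (- df).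
Proof. exact: is_deriveN. Qed.

Lemma is_derive1M f g t df dg : is_derive t 1 f df -> is_derive t 1 g dg ->
  is_derive t 1 (fun s => f s * g s) (df * g t + f t * dg).
Proof.
by move=> hf hg; apply: is_derive_eq (is_deriveM hf hg) _; rewrite addrC [df * _]mulrC.
Qed.

Lemma is_derive1V f t df : f t != 0 -> is_derive t 1 f df ->
  is_derive t 1 (fun s => (f s)^-1) (- df / f t ^+ 2).
Proof.
move=> f0 hf; apply: is_derive_eq (is_deriveV f0 hf) _.
by rewrite scaleNr mulNr mulrC.
Qed.

Lemma is_derive1X2 f t df : is_derive t 1 f df ->
  is_derive t 1 (fun s => f s ^+ 2) (2 * f t * df).
Proof.
move=> hf; apply: is_derive_eq (is_derive1M hf hf) _.
by ring.
Qed.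

Lemma is_derive1_expR f t df : is_derive t 1 f df ->
  is_derive t 1 (fun s => expR (f s)) (expR (f t) * df).
Proof. by move=> hf; apply: is_derive1_comp. Qed.

Lemma is_derive1_cos f t df : is_derive t 1 f df ->
  is_derive t 1 (fun s => cos (f s)) (- sin (f t) * df).
Proof. by move=> hf; apply: is_derive1_comp. Qed.

Lemma is_derive1_sin f t df : is_derive t 1 f df ->
  is_derive t 1 (fun s => sin (f s)) (cos (f t) * df).
Proof. by move=> hf; apply: is_derive1_comp. Qed.

Lemma is_derive1_ln_comp f t df : 0 < f t -> is_derive t 1 f df ->
  is_derive t 1 (fun s => ln (f s)) ((f t)^-1 * df).
Proof. by move=> f0 hf; apply: is_derive1_comp; exact: is_derive1_ln. Qed.

End PointwiseDerivatives.

Ltac derive_step := first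
  [ eassumption
  | eapply is_derive1_cst | eapply is_derive1_id
  | eapply is_derive1D | eapply is_derive1N
  | eapply is_derive1X2 | eapply is_derive1M
  | eapply is_derive1_expR | eapply is_derive1_cos | eapply is_derive1_sin
  | eapply is_derive1_ln_comp | eapply is_derive1V ].

(** * Mean value, boundedness and intermediate values *)

Section MeanValue.
Context {R : realType}.
Implicit Types (f df : R -> R) (a b s t : R).

Lemma mean_value f df a b : a < b ->
  (forall t, a < t < b -> is_derive t 1 f (df t)) ->
  (forall t, a <= t <= b -> {for t, continuous f}) ->
  exists2 c, a < c < b & f b - f a = df c * (b - a).
Proof.
move=> ab fd cf.
have fd' x : x \in `]a, b[%R -> is_derive x 1 f (df x).
  by rewrite in_itv; exact: fd.
have cf' : {within `[a, b], continuous f}.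
  by apply: continuous_in_subspaceT => x; rewrite inE/= in_itv/=; exact: cf.
by have [c] := MVT ab fd' cf'; rewrite in_itv => ? ?; exists c.
Qed.

Lemma bounded_derive_lipschitz (K : R) f df a b :
  (forall t, a < t < b -> is_derive t 1 f (df t)) ->
  (forall t, a <= t <= b -> {for t, continuous f}) ->
  (forall t, a < t < b -> `|df t| <= K) ->
  forall s t, a <= s -> s <= t -> t <= b -> `|f t - f s| <= K * (t - s).
Proof.
move=> fd cf dK s t as_ st tb.
have [->|nst] := eqVneq t s; first by rewrite !subrr normr0 mulr0.
have {nst}st : s < t by rewrite lt_neqAle eq_sym nst.
have [|x xst|c cst ->] := @mean_value f df s t st.
- by move=> x xst; apply: fd; lra.
- by apply: cf; lra.
- rewrite normrM (gtr0_norm (x := t - s)) ?subr_gt0// ler_wpM2r//.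
    by rewrite subr_ge0 ltW.
  by apply: dK; lra.
Qed.

Lemma continuous_bounded f a b : a <= b ->
  (forall t, a <= t <= b -> {for t, continuous f}) ->
  exists2 M, 0 <= M & forall t, a <= t <= b -> `|f t| <= M.
Proof.
move=> ab cf; have [|c _ cP] := @EVT_max R (fun t => `|f t|) a b ab.
  apply: continuous_in_subspaceT => x; rewrite inE/= in_itv/= => /cf cx.
  exact: cvg_norm.
by exists `|f c| => // t tab; apply: cP; rewrite in_itv.
Qed.

Lemma continuous_ivt f a b (v : R) : a <= b ->
  (forall t, a <= t <= b -> {for t, continuous f}) ->
  f a <= v <= f b -> exists2 c, a <= c <= b & f c = v.
Proof.
move=> ab cf /andP[av vb]; have [||c] := @IVT R f a b v ab.
- apply: continuous_in_subspaceT => x; rewrite inE/= in_itv/=; exact: cf.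
- by rewrite ge_min av le_max vb orbT.
- by rewrite in_itv => ? ?; exists c.
Qed.

End MeanValue.

(** * The flow of a linear focus and its uniqueness *)

Section Spiral.
Context {R : realType}.
Variables (a b : R).
Implicit Types (u v : R -> R) (p q s t : R).

(** With [spiral_y], the real and imaginary parts of [e^((a + i b) t) (p + i q)]. *)
Definition spiral_x p q t := expR (a * t) * (cos (b * t) * p - sin (b * t) * q).
Definition spiral_y p q t := expR (a * t) * (sin (b * t) * p + cos (b * t) * q).

Lemma is_derive_spiral_x p q t : is_derive t 1 (spiral_x p q)
  (a * spiral_x p q t - b * spiral_y p q t).
Proof.
by rewrite /spiral_x /spiral_y; eapply is_derive_eq; [repeat derive_step|rewrite /=; ring].
Qed.

Lemma is_derive_spiral_y p q t : is_derive t 1 (spiral_y p q)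
  (b * spiral_x p q t + a * spiral_y p q t).
Proof.
by rewrite /spiral_x /spiral_y; eapply is_derive_eq; [repeat derive_step|rewrite /=; ring].
Qed.

Hypothesis a0 : a < 0.

Lemma spiral_bound p q t : 0 <= t ->
  `|spiral_x p q t| <= `|p| + `|q| /\ `|spiral_y p q t| <= `|p| + `|q|.
Proof.
move=> t0; have e1 : expR (a * t) <= 1 by rewrite -expR0 ler_expR nmulr_rle0.
have c1 := cos_max (b * t); have s1 := sin_max (b * t).
have B (x y : R) : `|x| <= 1 -> `|y| <= 1 ->
    `|expR (a * t) * (x * p + y * q)| <= `|p| + `|q|.
  move=> x1 y1; rewrite normrM (ger0_norm (expR_ge0 _)).
  apply: (@le_trans _ _ (1 * `|x * p + y * q|)); first by rewrite ler_wpM2r.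
  rewrite mul1r (le_trans (ler_normD _ _))// !normrM lerD//.
    by rewrite ler_piMl.
  by rewrite ler_piMl.
by split; [rewrite /spiral_x -mulNr; apply: B; rewrite ?normrN|exact: B].
Qed.

Lemma spiral_lipschitz p q : exists2 K, 0 <= K & forall s t, 0 <= s -> s <= t ->
  `|spiral_x p q t - spiral_x p q s| <= K * (t - s) /\
  `|spiral_y p q t - spiral_y p q s| <= K * (t - s).
Proof.
pose M := `|p| + `|q|; have M0 : 0 <= M by rewrite addr_ge0.
exists (`|a| * M + `|b| * M); first by rewrite addr_ge0// mulr_ge0.
move=> s t s0 st; split.
- apply: (bounded_derive_lipschitz (a := 0) (b := t) (df := fun t =>
    a * spiral_x p q t - b * spiral_y p q t)) => //.
  + by move=> *; exact: is_derive_spiral_x.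
  + by move=> *; exact: (is_derive_continuous (is_derive_spiral_x _ _ _)).
  + move=> r /andP[r0 _]; have [] := spiral_bound p q (ltW r0).
    move: (spiral_x p q r) (spiral_y p q r) => X Y hX hY.
    apply: (le_trans (ler_normB _ _)); rewrite !normrM.
    by apply: lerD; apply: ler_wpM2l.
- apply: (bounded_derive_lipschitz (a := 0) (b := t) (df := fun t =>
    b * spiral_x p q t + a * spiral_y p q t)) => //.
  + by move=> *; exact: is_derive_spiral_y.
  + by move=> *; exact: (is_derive_continuous (is_derive_spiral_y _ _ _)).
  + move=> r /andP[r0 _]; have [] := spiral_bound p q (ltW r0).
    move: (spiral_x p q r) (spiral_y p q r) => X Y hX hY.
    apply: (le_trans (ler_normD _ _)); rewrite !normrM addrC.
    by apply: lerD; apply: ler_wpM2l.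
Qed.

(** The squared distance [E] to the explicit spiral satisfies [E' = 2 a E] almost everywhere, since
    the rotation cancels. As [a < 0] and [E] vanishes at [s], monotonicity alone gives [E = 0],
    without a Gronwall estimate. *)
Lemma spiral_unique u v s t : s <= t ->
  locally_absolutely_continuous u -> locally_absolutely_continuous v ->
  {ae @lebesgue_measure R, forall r, s < r < t ->
     is_derive r 1 u (a * u r - b * v r) /\
     is_derive r 1 v (b * u r + a * v r)} ->
  u t = spiral_x (u s) (v s) (t - s) /\ v t = spiral_y (u s) (v s) (t - s).
Proof.
move=> st acu acv ode.
pose x r := spiral_x (u s) (v s) (r - s); pose y r := spiral_y (u s) (v s) (r - s).
have [K K0 KP] := spiral_lipschitz (u s) (v s).
have dx (r : R) : is_derive r (1 : R) x (a * x r - b * y r).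
  rewrite -[X in is_derive _ _ _ X]mulr1.
  apply: (is_derive1_comp (f := spiral_x (u s) (v s)) (g := fun r => r - s)).
    exact: is_derive_spiral_x.
  by eapply is_derive_eq; [repeat derive_step|rewrite /=; ring].
have dy (r : R) : is_derive r (1 : R) y (b * x r + a * y r).
  rewrite -[X in is_derive _ _ _ X]mulr1.
  apply: (is_derive1_comp (f := spiral_y (u s) (v s)) (g := fun r => r - s)).
    exact: is_derive_spiral_y.
  by eapply is_derive_eq; [repeat derive_step|rewrite /=; ring].
have lip r r' : s <= r -> r <= r' -> `|x r' - x r| <= K * (r' - r) /\
    `|y r' - y r| <= K * (r' - r).
  move=> sr rr'; have -> : r' - r = (r' - s) - (r - s) by ring.
  by apply: KP; lra.
have acx : absolutely_continuous s t x.
  by apply: (absolutely_continuous_lipschitz K0) => r r' sr rr' _; case: (lip r r').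
have acy : absolutely_continuous s t y.
  by apply: (absolutely_continuous_lipschitz K0) => r r' sr rr' _; case: (lip r r').
pose p r := u r - x r; pose q r := v r - y r.
have sub1 (f g : R -> R) r r' : `|(f r' - g r') - (f r - g r)| <=
    1 * (`|f r' - f r| + `|g r' - g r|).
  rewrite mul1r (_ : _ - _ = (f r' - f r) - (g r' - g r)); last ring.
  exact: ler_normB.
have acp : absolutely_continuous s t p.
  by apply: (absolutely_continuous_le (K := 1) _ _ (acu s t) acx) => // *; exact: sub1.
have acq : absolutely_continuous s t q.
  by apply: (absolutely_continuous_le (K := 1) _ _ (acv s t) acy) => // *; exact: sub1.
have cp (r : R) : {for r, continuous p}.
  apply: continuousB; first exact: locally_ac_continuous.
  exact: is_derive_continuous (dx r).
have cq (r : R) : {for r, continuous q}.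
  apply: continuousB; first exact: locally_ac_continuous.
  exact: is_derive_continuous (dy r).
have [M M0 pM] := continuous_bounded st (fun r _ => cp r).
have [N N0 qN] := continuous_bounded st (fun r _ => cq r).
pose E r := p r ^+ 2 + q r ^+ 2.
have Es : E s = 0.
  rewrite /E /p /q /x /y /spiral_x /spiral_y subrr !mulr0 expR0 cos0 sin0; ring.
suff : E t <= 0.
  rewrite /E => Et; have p2 := sqr_ge0 (p t); have q2 := sqr_ge0 (q t).
  have /eqP : p t ^+ 2 = 0 by lra.
  have /eqP : q t ^+ 2 = 0 by lra.
  by rewrite !sqrf_eq0 !subr_eq0 => /eqP ? /eqP.
suff : - E s <= - E t by rewrite Es; lra.
have MN0 : 0 <= 2 * (M + N) by rewrite mulr_ge0// addr_ge0.
apply: (@ae_derive_ge0_le _ (fun r => - E r)) => //.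
  apply: (absolutely_continuous_le MN0 _ acp acq) => r r' sr rr' r't.
  have -> : - E r' - - E r = (p r' - p r) * - (p r' + p r)
    + (q r' - q r) * - (q r' + q r) by rewrite /E; ring.
  have := pM r; have := pM r'; have := qN r; have := qN r'.
  rewrite !sr !r't (le_trans sr rr') (le_trans rr' r't) => /(_ isT) h1 /(_ isT) h2 /(_ isT) h3 /(_ isT) h4.
  rewrite mulrDr; apply: (le_trans (ler_normD _ _)); rewrite !normrM !normrN.
  by apply: lerD; rewrite mulrC; apply: ler_wpM2r => //; apply: (le_trans (ler_normD _ _)); lra.
apply: ae_lebesgueS ode => r + rst => /(_ rst)[du dv].
have dxr := dx r; have dyr := dy r.
exists (- (2 * a) * E r); last first.
  by apply: mulr_ge0; [rewrite oppr_ge0 pmulr_rle0 ?(ltW a0)|apply: addr_ge0; apply: sqr_ge0].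
by rewrite /E /p /q; eapply is_derive_eq; [repeat derive_step|rewrite /=; ring].
Qed.

End Spiral.

(** * The central field *)

Section CentralField.
Context {R : realType}.
Variable eps : R.
Implicit Types (x y s t : R).

Definition field_num_x x y := y * (x ^+ 2 + y ^+ 2 + 2 * eps * x).
Definition field_num_y x y := x * (x ^+ 2 + y ^+ 2) + eps * (x ^+ 2 - y ^+ 2).
Definition field_den x y := (1 + eps * x) ^+ 2 + y ^+ 2.
Definition field_x x y := - field_num_x x y / field_den x y.
Definition field_y x y := field_num_y x y / field_den x y.
Definition first_integral x y :=
  ln (x ^+ 2 + y ^+ 2) / 2 - eps * x / (x ^+ 2 + y ^+ 2).

Lemma first_integral_even x y : first_integral x (- y) = first_integral x y.
Proof. by rewrite /first_integral sqrrN. Qed.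

Lemma is_derive_first_integral (x y : R -> R) t vx vy :
  0 < x t ^+ 2 + y t ^+ 2 -> is_derive t 1 x vx -> is_derive t 1 y vy ->
  is_derive t 1 (fun s => first_integral (x s) (y s))
    ((field_num_y (x t) (y t) * vx + field_num_x (x t) (y t) * vy)
      / (x t ^+ 2 + y t ^+ 2) ^+ 2).
Proof.
move=> r0 dx dy; rewrite /first_integral; eapply is_derive_eq.
  by repeat derive_step; rewrite ?gt_eqF.
by rewrite /= /field_num_x /field_num_y; field; rewrite gt_eqF.
Qed.

Hypothesis eps1 : -1 <= eps <= 1.

(** The gradient is bounded on the half-plane [x >= 1/2], which is convex, so the mean value theorem
    applies along the segment between the two points. *)
Lemma first_integral_lipschitz x y x' y' : 2^-1 <= x -> 2^-1 <= x' ->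
  `|first_integral x' y' - first_integral x y| <= 6 * (`|x' - x| + `|y' - y|).
Proof.
have num_le (u v : R) : 2^-1 <= u ->
    [/\ 0 < u ^+ 2 + v ^+ 2, `|field_num_y u v| <= 6 * (u ^+ 2 + v ^+ 2) ^+ 2 &
        `|field_num_x u v| <= 6 * (u ^+ 2 + v ^+ 2) ^+ 2].
  move=> u2; rewrite /field_num_x /field_num_y; move: eps1 => /andP[e1 e2].
  have v2 := sqr_ge0 v; have {}u2 : 1 <= 2 * u by lra.
  have uu : u <= 2 * u ^+ 2.
    by have : 0 <= u * (2 * u - 1); [apply: mulr_ge0; lra|lra].
  set r := u ^+ 2 + v ^+ 2.
  (* Away from the origin, terms of order [r] are absorbed by [4 r^2]; the constant 6 is this 4 plus
     the 2 coming from [u <= 2 r]. *)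
  have r4 : 1 <= 4 * r by rewrite /r; lra.
  have r40 : r <= 4 * r ^+ 2.
    by have : 0 <= r * (4 * r - 1); [apply: mulr_ge0; lra|lra].
  have ur : u <= 2 * r by rewrite /r; lra.
  have vr : `|v| <= r.
    have p1 := sqr_ge0 (v - 2^-1); have p2 := sqr_ge0 (v + 2^-1).
    by rewrite ler_norml /r; lra.
  have uvr : `|2 * u * v| <= r.
    by have p1 := sqr_ge0 (u - v); have p2 := sqr_ge0 (u + v); rewrite ler_norml /r; lra.
  split; first lra.
  - apply: (le_trans (ler_normD _ _)).
    have h1 : `|u * r| <= 2 * r ^+ 2 by rewrite ger0_norm; nra.
    suff : `|eps * (u ^+ 2 - v ^+ 2)| <= 4 * r ^+ 2 by lra.
    apply: le_trans r40; rewrite normrM -[leRHS]mul1r; apply: ler_pM => //.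
      by rewrite ler_norml e1.
    by rewrite ler_norml /r; nra.
  - have -> : v * (r + 2 * eps * u) = v * r + eps * (2 * u * v) by ring.
    apply: (le_trans (ler_normD _ _)).
    have h1 : `|v * r| <= r ^+ 2.
      by rewrite normrM expr2 (ger0_norm (x := r)) ?ler_wpM2r//; lra.
    suff : `|eps * (2 * u * v)| <= 4 * r ^+ 2 by have := sqr_ge0 r; lra.
    apply: le_trans r40; rewrite normrM -[leRHS]mul1r; apply: ler_pM => //.
    by rewrite ler_norml e1.
have dH (u v w z q s : R) : 0 < q -> 2^-1 <= u + s * w -> `|w| + `|z| <= q ->
    exists2 d, is_derive s 1 (fun s => first_integral (u + s * w) (v + s * z)) d
      & `|d| <= 6 * q.
  move=> q0 us wz; have [r0 h1 h2] := num_le _ (v + s * z) us.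
  have dx : is_derive s 1 (fun s => u + s * w) w.
    by eapply is_derive_eq; [repeat derive_step|rewrite /=; ring].
  have dy : is_derive s 1 (fun s => v + s * z) z.
    by eapply is_derive_eq; [repeat derive_step|rewrite /=; ring].
  have /= dd := @is_derive_first_integral (fun s => u + s * w)
    (fun s => v + s * z) s _ _ r0 dx dy; eexists; first exact: dd.
  have r20 : 0 < ((u + s * w) ^+ 2 + (v + s * z) ^+ 2) ^+ 2 by rewrite exprn_gt0.
  rewrite normrM normfV (gtr0_norm r20) ler_pdivrMr//.
  apply: (le_trans (ler_normD _ _)); rewrite 2!normrM.
  apply: (@le_trans _ _ (6 * ((u + s * w) ^+ 2 + (v + s * z) ^+ 2) ^+ 2 * `|w|
      + 6 * ((u + s * w) ^+ 2 + (v + s * z) ^+ 2) ^+ 2 * `|z|)).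
    by apply: lerD; apply: ler_wpM2r.
  by rewrite -mulrDr [leRHS]mulrAC ler_wpM2l// mulr_ge0// ltW.
move=> hx hx'; pose q : R := `|x' - x| + `|y' - y|; rewrite -/q.
have [q0|] := ltP 0 q; last first.
  rewrite /q => q0; have := normr_ge0 (x' - x); have := normr_ge0 (y' - y) => h1 h2.
  have /eqP : `|x' - x| = 0 by lra.
  have /eqP : `|y' - y| = 0 by lra.
  rewrite !normr_eq0 !subr_eq0 => /eqP -> /eqP ->.
  by rewrite !subrr normr0 addr0 mulr0.
pose w : R := x' - x; pose z : R := y' - y.
have seg (s : R) : 0 <= s <= 1 -> 2^-1 <= x + s * w by rewrite /w; nra.
have dP (s : R) : 0 <= s <= 1 -> exists2 d,
    is_derive s 1 (fun s => first_integral (x + s * w) (y + s * z)) d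
      & `|d| <= 6 * q by move=> /seg hs; exact: dH.
have [df dfP] : exists df : R -> R, forall s, 0 <= s <= 1 ->
    is_derive s 1 (fun s => first_integral (x + s * w) (y + s * z)) (df s) /\
    `|df s| <= 6 * q.
  have : forall s, exists d, 0 <= s <= 1 ->
      is_derive s 1 (fun s => first_integral (x + s * w) (y + s * z)) d /\
      `|d| <= 6 * q.
    move=> s; have [/dP[d ? ?]|] := pselect (0 <= s <= 1); first by exists d.
    by exists 0.
  by move=> /choice[f fP]; exists f.
have lt01' (s : R) : 0 < s < 1 -> 0 <= s <= 1 by lra.
have := @bounded_derive_lipschitz _ (6 * q)
  (fun s => first_integral (x + s * w) (y + s * z)) df 0 1
  (fun s h => (dfP s (lt01' s h)).1)
  (fun s h => is_derive_continuous (dfP s h).1)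
  (fun s h => (dfP s (lt01' s h)).2) 0 1 (lexx _) ler01 (lexx _).
by rewrite !mul1r !mul0r !addr0 subr0 mulr1 /w /z !subrKC.
Qed.

End CentralField.

(** The derivative in [x] is [field_num_y] divided by a positive square, so the level increases to
    the right wherever the flow rises. *)
Lemma first_integral_increasing_num {R : realType} (eps e x1 x2 y : R) : 0 < e ->
  (forall x, e < x -> 0 < field_num_y eps x y) -> e <= x1 -> x1 < x2 ->
  first_integral eps x1 y < first_integral eps x2 y.
Proof.
move=> e0 num0 ex xx; rewrite -subr_gt0.
have r0 s : e <= s -> 0 < s ^+ 2 + y ^+ 2.
  by move=> es; rewrite ltr_wpDr ?sqr_ge0// exprn_gt0// (lt_le_trans e0).
pose df s := field_num_y eps s y / (s ^+ 2 + y ^+ 2) ^+ 2.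
have dH s : e <= s -> is_derive s 1 (fun s => first_integral eps s y) (df s).
  move=> /r0 rs; have := @is_derive_first_integral R eps id (cst y) s 1 0 rs.
  by rewrite mulr1 mulr0 addr0; apply.
have dH1 s : x1 < s < x2 -> is_derive s 1 (fun s => first_integral eps s y) (df s).
  by move=> /andP[xs _]; apply: dH; rewrite (le_trans ex)// ltW.
have cH1 s : x1 <= s <= x2 -> {for s, continuous (fun s => first_integral eps s y)}.
  by move=> /andP[xs _]; apply: is_derive_continuous (dH s _); rewrite (le_trans ex).
have [c /andP[xc _] ->] := mean_value xx dH1 cH1.
have ec : e < c := le_lt_trans ex xc.
by rewrite mulr_gt0 ?subr_gt0// divr_gt0 ?num0// exprn_gt0// r0// ltW.
Qed.

(** The time [t0] itself is left out of [P] because the starting point may lie on a discontinuity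
    line. The last clause includes [t1], so that it is refuted as soon as [P] is an open condition
    that holds at [t1]. *)
Lemma first_exit {R : realType} (P : R -> Prop) (t0 T : R) :
  (exists2 d, 0 < d & forall s, t0 < s < t0 + d -> P s) ->
  (forall t, t0 < t -> (forall s, t0 < s <= t -> P s) -> t <= T) ->
  exists t1, [/\ t0 < t1, t1 <= T, forall s, t0 < s < t1 -> P s &
    ~ exists2 d, 0 < d & forall s, t1 <= s < t1 + d -> P s].
Proof.
move=> [d d0 dP] PT; pose A := [set t | t0 < t /\ forall s, t0 < s <= t -> P s].
have Ad : A (t0 + d / 2).
  by split; [lra|move=> s hs; apply: dP; lra].
have ubA : ubound A T by move=> t [? ?]; exact: PT.
have supA : has_sup A by split; [exists (t0 + d / 2)|exists T].
have ubA' : has_ubound A by exists T.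
have t01 : t0 < sup A by apply: (lt_le_trans Ad.1); exact: ub_le_sup.
have Pin s : t0 < s < sup A -> P s.
  move=> /andP[t0s ss]; have ss0 : 0 < sup A - s by lra.
  have [t [t0t tP] st] := sup_adherent ss0 supA.
  by apply: tP; lra.
exists (sup A); split => //; first by apply: ge_sup => //; exists (t0 + d / 2).
move=> [r r0 rP].
have : A (sup A + r / 2).
  split; first lra.
  move=> s /andP[t0s sr]; have [ss|ss] := ltP s (sup A); first by apply: Pin; rewrite t0s.
  by apply: rP; lra.
by move=> /(ub_le_sup ubA'); lra.
Qed.

(** * Half turns of solutions *)

Lemma continuous_gt {R : realType} (f : R -> R) (c t : R) :
  {for t, continuous f} -> c < f t ->
  exists2 d : R, 0 < d & forall s, `|s - t| < d -> c < f s.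
Proof.
move=> cf cft; have [||d d0 dP] := @continuous_gt0 R (fun s => f s - c) t.
- by apply: continuousB => //; exact: cst_continuous.
- by rewrite subr_gt0.
by exists d => // s /dP; rewrite subr_gt0.
Qed.

Lemma continuous_lt {R : realType} (f : R -> R) (c t : R) :
  {for t, continuous f} -> f t < c ->
  exists2 d : R, 0 < d & forall s, `|s - t| < d -> f s < c.
Proof.
move=> cf cft; have [||d d0 dP] := @continuous_gt0 R (fun s => c - f s) t.
- by apply: continuousB => //; exact: cst_continuous.
- by rewrite subr_gt0.
by exists d => // s /dP; rewrite subr_gt0.
Qed.

Lemma continuous_le_left {R : realType} (f : R -> R) (c a b : R) : a < b ->
  {for b, continuous f} -> (forall s, a < s < b -> c <= f s) -> c <= f b.
Proof.
move=> ab cf cP; rewrite leNgt; apply/negP => /(continuous_lt cf)[d d0 dP].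
pose s := Num.max (b - d / 2) ((a + b) / 2).
have h1 : b - d / 2 <= s by rewrite le_max lexx.
have h2 : (a + b) / 2 <= s by rewrite le_max lexx orbT.
have h3 : s < b by rewrite gt_max; apply/andP; split; lra.
have /dP : `|s - b| < d by rewrite ltr_norml; lra.
have /cP : a < s < b by lra.
lra.
Qed.

Section HalfTurn.
Context {R : realType}.
Variables (al be k al' be' k' eps e m : R).
Implicit Types (x y : R -> R) (s t : R).

Local Notation H := (first_integral eps).
Local Notation fx := (field_x eps).
Local Notation fy := (field_y eps).

(* The constraints on the velocity (vx, vy) at (x, y) that are used to follow a
   trajectory from the line y = -1 on the right through the strip and the upper
   half-plane, where the focus is (-k, 1); the focus of the lower half-plane is
   (k', -1). *)
Definition half_velocity (x y vx vy : R) : Prop :=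
  [/\ 1 < y -> vx = al * (x + k) - be * (y - 1) /\
               vy = be * (x + k) + al * (y - 1),
      -1 < y < 1 -> vx = fx x y /\ vy = fy x y,
      y < -1 -> vy = be' * (x - k') + al' * (y + 1) &
      (y = 1 \/ y = -1) -> k' < x -> 0 < vy].

Definition half_solution x y : Prop :=
  [/\ locally_absolutely_continuous x, locally_absolutely_continuous y &
      {ae @lebesgue_measure R, forall t, exists vx vy,
        [/\ is_derive t 1 x vx, is_derive t 1 y vy &
            half_velocity (x t) (y t) vx vy]}].

(** To the right of [x = e] the central flow rises with speed at least [m]. [hp_edge] makes this
    vertical line a barrier: no level above that of [(k', 1)] meets it in the strip. [hp_e] places
    the region in the domain of the Lipschitz estimate for the first integral. *)
Record half_params : Prop := HalfParams {
  hp_al : al < 0; hp_be : 0 < be; hp_al' : al' < 0; hp_be' : 0 < be';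
  hp_eps : -1 <= eps <= 1; hp_e : 2^-1 <= e; hp_k' : e < k'; hp_k : 0 < k;
  hp_m : 0 < m;
  hp_field : forall x y : R, e < x -> -1 <= y <= 1 -> m <= fy x y;
  hp_edge : forall y : R, -1 <= y <= 1 -> H e y < H k' 1 }.

Hypothesis hp : half_params.

Let al0 : al < 0. Proof. by case: hp. Qed.
Let be0 : 0 < be. Proof. by case: hp. Qed.
Let al'0 : al' < 0. Proof. by case: hp. Qed.
Let be'0 : 0 < be'. Proof. by case: hp. Qed.
Let eps1 : -1 <= eps <= 1. Proof. by case: hp. Qed.
Let e2 : 2^-1 <= e. Proof. by case: hp. Qed.
Let ek' : e < k'. Proof. by case: hp. Qed.
Let k0 : 0 < k. Proof. by case: hp. Qed.
Let m0 : 0 < m. Proof. by case: hp. Qed.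
Let fy_ge (x y : R) : e < x -> -1 <= y <= 1 -> m <= fy x y.
Proof. exact: hp_field hp x y. Qed.
Let He (y : R) : -1 <= y <= 1 -> H e y < H k' 1.
Proof. exact: hp_edge hp y. Qed.

Ltac params_lra := pose proof al0; pose proof be0; pose proof al'0; pose proof be'0;
  pose proof e2; pose proof ek'; pose proof k0; pose proof m0; lra.

Lemma field_signs (x y : R) : e < x -> -1 <= y <= 1 ->
  0 < field_den eps x y /\ 0 < field_num_y eps x y.
Proof.
move=> ex y1; have := fy_ge ex y1; rewrite /field_y => mf.
have d0 : 0 < field_den eps x y.
  have : 0 <= field_den eps x y by rewrite /field_den addr_ge0 ?sqr_ge0.
  (* A zero denominator would give [field_y] the value 0, because the inverse of 0 is 0, against the
     bound [m]. *)
  rewrite le_eqVlt => /orP[/eqP d0|//]; move: mf; rewrite -d0 invr0 mulr0; params_lra.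
by split => //; move: mf; rewrite ler_pdivlMr// => /(lt_le_trans _); apply; exact: mulr_gt0.
Qed.

Lemma first_integral_increasing (x1 x2 y : R) : e <= x1 -> x1 < x2 ->
  -1 <= y <= 1 -> H x1 y < H x2 y.
Proof.
move=> ex xx y1; apply: first_integral_increasing_num ex xx; first params_lra.
by move=> x ex; have [] := field_signs ex y1.
Qed.

Lemma first_integral_inj (x1 x2 y : R) : e < x1 -> e < x2 -> -1 <= y <= 1 ->
  H x1 y = H x2 y -> x1 = x2.
Proof.
move=> e1 e2' y1 HH; have [xx|xx|//] := ltgtP x1 x2.
  by have := first_integral_increasing (ltW e1) xx y1; rewrite HH ltxx.
by have := first_integral_increasing (ltW e2') xx y1; rewrite HH ltxx.
Qed.

(** * Passages of a trajectory through the strip and through the upper half-plane *)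

Section Trajectory.
Variables (x y : R -> R).
Hypothesis xy : half_solution x y.

Let cx t : {for t, continuous x}.
Proof. by case: xy => /locally_ac_continuous/(_ t). Qed.

Let cy t : {for t, continuous y}.
Proof. by case: xy => _ /locally_ac_continuous/(_ t). Qed.

(** The positive velocity is required in every regime near [t], including the line itself, since the
    times spent on it are not known in advance to be negligible. *)
Lemma crossing_increasing t d : 0 < d ->
  (forall s vx vy, `|s - t| < d -> half_velocity (x s) (y s) vx vy -> 0 < vy) ->
  forall s, t < s < t + d -> y t < y s.
Proof.
move=> d0 dP s std; case: xy => acx acy ode.
apply: ae_derive_gt0_lt; [params_lra|exact: acy|].
apply: ae_lebesgueS ode => r [vx [vy [dx dy hv]]] rs; exists vy => //.
by apply: dP hv; rewrite ltr_norml; params_lra.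
Qed.

Lemma enter_strip t : y t = -1 -> k' < x t ->
  exists2 d, 0 < d & forall s, t < s < t + d -> -1 < y s < 1 /\ e < x s.
Proof.
move=> yt xt; have [d1 d10 d1P] := continuous_gt (@cx t) xt.
have [|d2 d20 d2P] := continuous_lt (c := 1) (@cy t); first by rewrite yt; params_lra.
have d0 : 0 < Num.min d1 d2 by rewrite lt_min d10.
exists (Num.min d1 d2) => // s std.
have sd r : t < r < t + Num.min d1 d2 -> `|r - t| < Num.min d1 d2.
  by move=> hr; rewrite ltr_norml; params_lra.
have := sd _ std; rewrite lt_min => /andP[/d1P xs /d2P ys].
split; last params_lra; rewrite ys andbT -yt.
apply: (crossing_increasing d0) std => r vx vy; rewrite lt_min => /andP[/d1P xr /d2P yr].
case=> _ h2 h3 h4; have [y1|y1|y1] := ltgtP (y r) (-1).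
- rewrite h3//; apply: addr_gt0; first by rewrite mulr_gt0// subr_gt0.
  by rewrite nmulr_rgt0//; params_lra.
- have [|_ ->] := h2; first by rewrite y1.
  by apply: lt_le_trans m0 _; apply: fy_ge; params_lra.
- by apply: h4; [right|].
Qed.

Lemma enter_top t : y t = 1 -> k' < x t ->
  exists2 d, 0 < d & forall s, t < s < t + d -> 1 < y s.
Proof.
move=> yt xt; have [d1 d10 d1P] := continuous_gt (@cx t) xt.
have [|d2 d20 d2P] := continuous_gt (c := -1) (@cy t); first by rewrite yt; params_lra.
have [||d3 d30 d3P] := @continuous_gt R (fun s => be * (x s + k) + al * (y s - 1)) 0 t.
- apply: continuousD; apply: continuousM; try exact: cst_continuous.
    by apply: continuousD => //; exact: cst_continuous.
  by apply: continuousB => //; exact: cst_continuous.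
- by rewrite yt subrr mulr0 addr0 mulr_gt0//; params_lra.
have d0 : 0 < Num.min d1 (Num.min d2 d3) by rewrite !lt_min d10 d20.
exists (Num.min d1 (Num.min d2 d3)) => // s std; rewrite -yt.
apply: (crossing_increasing d0) std => r vx vy.
rewrite !lt_min => /and3P[/d1P xr /d2P yr /d3P vr] [h1 h2 _ h4].
have [y1|y1|y1] := ltgtP (y r) 1.
- have [|_ ->] := h2; first by rewrite yr.
  by apply: lt_le_trans m0 _; apply: fy_ge; params_lra.
- by have [|_ ->] := h1.
- by apply: h4; [left|].
Qed.

(** The level stays constant until the exit from the region. Being larger than [H k' 1], it excludes
    an exit through [x = e]; since the height increases, only [y = 1] remains, and there
    monotonicity of the level in [x] gives [k' < x]. *)
Lemma strip_passage t0 : e < x t0 -> -1 <= y t0 < 1 ->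
  (y t0 = -1 -> k' < x t0) -> H k' 1 < H (x t0) (y t0) ->
  exists t1, [/\ t0 < t1, y t1 = 1, k' < x t1 &
    forall t, t0 <= t <= t1 ->
      [/\ e < x t, -1 <= y t <= 1 & H (x t) (y t) = H (x t0) (y t0)]].
Proof.
move=> ex0 y0 xk' H0; case: (xy) => acx acy ode.
have step t : e < x t -> -1 < y t < 1 ->
    exists2 d, 0 < d & forall s, `|s - t| < d -> -1 < y s < 1 /\ e < x s.
  move=> et /andP[y1 y2]; have [d1 d10 d1P] := continuous_gt (@cx t) et.
  have [d2 d20 d2P] := continuous_gt (@cy t) y1; have [d3 d30 d3P] := continuous_lt (@cy t) y2.
  exists (Num.min d1 (Num.min d2 d3)); first by rewrite !lt_min d10 d20.
  by move=> s; rewrite !lt_min => /and3P[/d1P -> /d2P -> /d3P ->].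
have start : exists2 d, 0 < d & forall s, t0 < s < t0 + d -> -1 < y s < 1 /\ e < x s.
  move: y0 => /andP[]; rewrite le_eqVlt => /orP[/eqP y0 _|y1 y2].
    by apply: enter_strip; [|exact: xk'].
  have [|d d0 dP] := step _ ex0; first by rewrite y1.
  by exists d => // s hs; apply: dP; rewrite ltr_norml; params_lra.
have rate t : t0 < t -> (forall s, t0 < s < t -> -1 < y s < 1 /\ e < x s) ->
    m * (t - t0) <= y t - y t0.
  move=> t0t P; apply: ae_derive_ge_le; [exact: ltW|exact: acy|].
  apply: ae_lebesgueS ode => s [vx [vy [dx dy [_ h2 _ _]]]] /P[ys xs].
  exists vy => //; have [_ ->] := h2 ys; apply: fy_ge => //; params_lra.
(* The strip has height 2 and is climbed at speed at least [m], whence the time bound [2 / m]. *)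
have [|t1 [t01 _ tP tN]] := @first_exit R (fun s => -1 < y s < 1 /\ e < x s)
    t0 (t0 + 2 / m) start.
  move=> t t0t P; rewrite -lerBlDl ler_pdivlMr// mulrC.
  have := rate t t0t (fun s hs => P s ltac:(params_lra)).
  have [] := P t; first params_lra.
  by move: y0; params_lra.
have cl t : t0 <= t <= t1 -> e <= x t /\ -1 <= y t <= 1.
  move=> tt; have [->|nt0] := eqVneq t t0; first params_lra.
  have [->|nt1] := eqVneq t t1.
    split; first by apply: continuous_le_left t01 (@cx t1) _ => s /tP[_ /ltW].
    apply/andP; split; first by apply: continuous_le_left t01 (@cy t1) _ => s /tP[/andP[/ltW]].
    rewrite -lerN2; apply: (@continuous_le_left R (fun s => - y s) _ t0) => //.
      by apply: continuousN; exact: cy.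
    by move=> s /tP[/andP[_ /ltW ?] _]; rewrite lerN2.
  have [] := tP t; last params_lra.
  by rewrite !lt_neqAle nt1 eq_sym nt0.
have HH t : t0 <= t <= t1 -> H (x t) (y t) = H (x t0) (y t0).
  move=> /andP[t0t tt1].
  apply: (@ae_derive_eq0_cst R (fun t => H (x t) (y t))) => //.
    have K6 : 0 <= 6 :> R by [].
    apply: (absolutely_continuous_le K6 _ (acx _ _) (acy _ _)) => r s h1 h2 h3.
    have [|er _] := cl r; first params_lra.
    have [|es _] := cl s; first params_lra.
    by apply: first_integral_lipschitz => //; params_lra.
  apply: ae_lebesgueS ode => s [vx [vy [dx dy [_ h2 _ _]]]] /andP[hs1 hs2].
  have [|ys es] := tP s; first params_lra.
  have [vxE vyE] := h2 ys; have ys' : -1 <= y s <= 1 by params_lra.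
  have [D0 _] := field_signs es ys'.
  have r0 : 0 < x s ^+ 2 + y s ^+ 2.
    have : 0 < x s ^+ 2 by apply: exprn_gt0; params_lra.
    by have := sqr_ge0 (y s); params_lra.
  have := is_derive_first_integral eps r0 dx dy.
  rewrite vxE vyE /field_x /field_y.
  rewrite (_ : field_num_y _ _ _ * _ + _ = 0) ?mul0r//.
  by field; rewrite gt_eqF.
have [|xe1 y1] := cl t1; first params_lra.
have H1 : H (x t1) (y t1) = H (x t0) (y t0) by apply: HH; params_lra.
have ex1 : e < x t1.
  rewrite lt_neqAle xe1 andbT; apply/eqP => ext; move: H1.
  by have := He y1; rewrite ext; move: H0 => /[swap] /lt_trans /[apply] /[swap] ->; rewrite ltxx.
have yt1 : y t1 = 1.
  move: (y1) => /andP[_]; rewrite le_eqVlt => /orP[/eqP //|yt].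
  exfalso; apply: tN; have ylt : -1 < y t1.
    have mt : 0 < m * (t1 - t0) by rewrite mulr_gt0 ?subr_gt0.
    by have := rate _ t01 tP; lra.
  have [|d d0 dP] := step _ ex1; first by rewrite ylt.
  by exists d => // s hs; apply: dP; rewrite ltr_norml; params_lra.
exists t1; split => //.
- rewrite ltNge; apply/negP => xk; move: H1; rewrite yt1 => H1.
  have y11 : -1 <= (1 : R) <= 1 by params_lra.
  have : H (x t1) 1 <= H k' 1.
    move: xk; rewrite le_eqVlt => /orP[/eqP -> //|xk].
    exact: ltW (first_integral_increasing xe1 xk y11).
  by rewrite H1 leNgt H0.
- move=> t tt; have [et yt] := cl t tt; split => //; last exact: HH.
  move: et; rewrite le_eqVlt => /orP[/eqP et|//].
  by have := He yt; rewrite et (HH t tt); move: H0 => /lt_trans /[apply]; rewrite ltxx.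
Qed.

(** While the trajectory is above the line it is the spiral, and after half a period the spiral has
    [y - 1] multiplied by a negative number. Hence it is back on the line by then. *)
Lemma top_passage t0 : 1 <= y t0 ->
  (exists2 d, 0 < d & forall s, t0 < s < t0 + d -> 1 < y s) ->
  exists t1, [/\ t0 < t1 <= t0 + pi / be, y t1 = 1 &
    forall t, t0 <= t <= t1 ->
      x t = spiral_x al be (x t0 + k) (y t0 - 1) (t - t0) - k /\
      y t = spiral_y al be (x t0 + k) (y t0 - 1) (t - t0) + 1].
Proof.
move=> y0 start; case: (xy) => acx acy ode.
have shiftAC (f : R -> R) c : locally_absolutely_continuous f ->
    locally_absolutely_continuous (fun t => f t + c).
  move=> acf a b; apply: (@absolutely_continuous_le _ 1 f f) => // s t _ _ _.
  by rewrite mul1r opprD addrACA subrr addr0 lerDl.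
have formula t : t0 <= t -> (forall s, t0 < s < t -> 1 < y s) ->
    x t = spiral_x al be (x t0 + k) (y t0 - 1) (t - t0) - k /\
    y t = spiral_y al be (x t0 + k) (y t0 - 1) (t - t0) + 1.
  move=> t0t P; have [|u v] := @spiral_unique R al be al0 (fun t => x t + k)
    (fun t => y t - 1) t0 t t0t (shiftAC x k acx) (shiftAC y (-1) acy).
  + apply: ae_lebesgueS ode => s [vx [vy [dx dy [h1 _ _ _]]]] /P ys.
    have [vxE vyE] := h1 ys.
    by split; eapply is_derive_eq; [repeat derive_step|rewrite /=; lra|
      repeat derive_step|rewrite /=; lra].
  + by rewrite -u -v; split; ring.
have [t t0t P|t1 [t01 t1T tP tN]] := @first_exit R (fun s => 1 < y s)
    t0 (t0 + pi / be) start.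
  rewrite leNgt; apply/negP => tT; pose s := t0 + pi / be.
  have pb : 0 < pi / be by rewrite divr_gt0 ?pi_gt0.
  have [||_] := formula s; rewrite /s; [params_lra|move=> r hr; apply: P; params_lra|].
  have -> : t0 + pi / be - t0 = pi / be by ring.
  rewrite /spiral_y [be * (pi / be)]mulrC divfK ?gt_eqF// sinpi cospi.
  have := P s; rewrite /s => /(_ ltac:(params_lra)) ys.
  rewrite mul0r add0r mulN1r mulrN.
  have : 0 <= expR (al * (pi / be)) * (y t0 - 1) by rewrite mulr_ge0 ?expR_ge0 ?subr_ge0.
  lra.
exists t1; split; first by rewrite t01.
- have : 1 <= y t1 by apply: continuous_le_left t01 (@cy t1) _ => s /tP/ltW.
  rewrite le_eqVlt => /orP[/eqP //|yt1]; exfalso; apply: tN.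
  have [d d0 dP] := continuous_gt (@cy t1) yt1.
  by exists d => // s hs; apply: dP; rewrite ltr_norml; lra.
- move=> t /andP[t0t tt1]; apply: formula => // s hs; apply: tP; lra.
Qed.

Lemma top_reach t0 : 1 < y t0 -> exists t1, [/\ t0 < t1, y t1 = 1 & x t1 < - k].
Proof.
move=> y0; have [|t1 [/andP[t01 t1T] yt1 tP]] := top_passage (ltW y0).
  have [d d0 dP] := continuous_gt (@cy t0) y0.
  by exists d => // s hs; apply: dP; rewrite ltr_norml; lra.
exists t1; split => //; have [|-> yE] := tP t1; first by rewrite lexx ltW.
move: yE; rewrite yt1 /spiral_x /spiral_y.
set a := be * (t1 - t0); set E := expR _; set u := x t0 + k; set v := y t0 - 1.
have E0 : 0 < E := expR_gt0 _.
have v0 : 0 < v by rewrite subr_gt0.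
move=> yE; have {yE}/eqP : E * (sin a * u + cos a * v) = 0 by lra.
rewrite mulf_eq0 gt_eqF//= => /eqP yE.
have a0 : 0 < a by rewrite mulr_gt0 ?subr_gt0.
have api : a <= pi.
  by rewrite /a mulrC -ler_pdivlMr//; lra.
have s0 : 0 < sin a.
  move: api; rewrite le_eqVlt => /orP[/eqP aE|aL]; last first.
    by apply: sin_gt0_pi; rewrite a0.
  by move: yE; rewrite aE sinpi cospi; lra.
suff : cos a * u - sin a * v < 0.
  by move=> h; have : E * (cos a * u - sin a * v) < 0; [rewrite pmulr_rlt0|lra].
suff : sin a * (cos a * u - sin a * v) < 0 by rewrite pmulr_rlt0.
(* Multiplying by [sin a > 0] brings in the equation of arrival on the line; what is left is
   [- v < 0], so the arrival is to the left of the focus whatever the starting point. *)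
have -> : sin a * (cos a * u - sin a * v) =
    cos a * (sin a * u + cos a * v) - (cos a ^+ 2 + sin a ^+ 2) * v by ring.
by rewrite yE mulr0 cos2Dsin2; lra.
Qed.

(** From the line, the height is proportional to a sine, whose first zero after the start is at
    angle [pi]: the duration does not depend on the starting abscissa, which makes the half turn
    affine. *)
Lemma top_turn t0 : y t0 = 1 -> k' < x t0 ->
  [/\ y (t0 + pi / be) = 1,
      x (t0 + pi / be) = - k - expR (al * (pi / be)) * (x t0 + k) &
      forall t, 0 <= t <= pi / be ->
        x (t0 + t) = spiral_x al be (x t0 + k) 0 t - k /\
        y (t0 + t) = spiral_y al be (x t0 + k) 0 t + 1].
Proof.
move=> y0 xk; have [|t1 [/andP[t01 t1T] yt1 tP]] := top_passage _ (enter_top y0 xk).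
  by rewrite y0.
move: tP; rewrite y0 subrr => tP.
have [|_ ] := tP t1; first by rewrite lexx ltW.
rewrite yt1 /spiral_y mulr0 addr0 => yE.
have {yE}/eqP : expR (al * (t1 - t0)) * (sin (be * (t1 - t0)) * (x t0 + k)) = 0.
  by lra.
rewrite !mulf_eq0 (gt_eqF (expR_gt0 _))/=.
rewrite (gt_eqF (x := x t0 + k)) ?orbF; last params_lra.
move=> /eqP s0; have t1E : t1 = t0 + pi / be.
  apply/eqP; rewrite eq_le t1T/=; rewrite leNgt; apply/negP => lt.
  have : 0 < sin (be * (t1 - t0)).
    apply: sin_gt0_pi; apply/andP; split; first by rewrite mulr_gt0 ?subr_gt0.
    by rewrite mulrC -ltr_pdivlMr//; lra.
  by rewrite s0 ltxx.
have tP' t : 0 <= t <= pi / be ->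
    x (t0 + t) = spiral_x al be (x t0 + k) 0 t - k /\
    y (t0 + t) = spiral_y al be (x t0 + k) 0 t + 1.
  by move=> ht; have := tP (t0 + t); rewrite t1E [t0 + t]addrC addrK; apply; lra.
split => //; first by rewrite -t1E.
have pb : 0 <= pi / be by rewrite divr_ge0 ?pi_ge0 ?ltW.
have [|-> _] := tP' (pi / be); first by rewrite pb lexx.
rewrite /spiral_x [be * _]mulrC divfK ?gt_eqF// cospi sinpi; ring.
Qed.

(** A point above the critical level is carried through the strip to [y = 1] beyond [k'] and then
    makes an exact half turn; a point already above the line comes down to the left of the focus. *)
Lemma half_reach t0 :
  1 < y t0 \/ [/\ e < x t0, -1 <= y t0 <= 1 & H k' 1 < H (x t0) (y t0)] ->
  exists t1, y t1 = 1 /\ x t1 < - k.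
Proof.
have top t : y t = 1 -> k' < x t -> exists t1, y t1 = 1 /\ x t1 < - k.
  move=> yt xt; have [y1 x1 _] := top_turn yt xt; exists (t + pi / be).
  rewrite x1; split => //; rewrite gtrDl oppr_lt0 mulr_gt0 ?expR_gt0//; params_lra.
have k'lt s : e < s -> H k' 1 < H s 1 -> k' < s.
  move=> es Hs; rewrite ltNge; apply/negP; rewrite le_eqVlt => /orP[/eqP sk|sk].
    by move: Hs; rewrite sk ltxx.
  have y11 : -1 <= (1 : R) <= 1 by lra.
  by have := lt_trans Hs (first_integral_increasing (ltW es) sk y11); rewrite ltxx.
case=> [/top_reach[t1 [_ ? ?]]|[ex /andP[y1 y2] H0]]; first by exists t1.
move: y2; rewrite le_eqVlt => /orP[/eqP y0|y2].
  by apply: (top t0) => //; apply: k'lt => //; move: H0; rewrite y0.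
have [||t1 [_ yt1 xt1 _]] := strip_passage ex _ _ H0; last exact: top yt1 xt1.
  by rewrite y1.
by move=> y0; apply: k'lt => //; move: H0; rewrite y0 first_integral_even.
Qed.

(** The trace of a half turn from [(X, -1)], a piece of a level set and a half spiral, described
    without any solution, so that orbits of different solutions can be compared as sets. *)
Definition half_arc (X px py : R) : Prop :=
  [/\ e < px, -1 <= py <= 1 & H px py = H X 1] \/
  exists2 t, 0 <= t <= pi / be &
    px = spiral_x al be (X + k) 0 t - k /\ py = spiral_y al be (X + k) 0 t + 1.

(** The abscissa is unchanged by the strip, because the first integral is even in [y] and injective
    in [x]. The lower bound on the duration ensures later that successive turns exhaust the
    future. *)
Lemma half_turn t0 : y t0 = -1 -> k' < x t0 ->
  exists t1, [/\ t0 + pi / be <= t1, y t1 = 1,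
    x t1 = - k - expR (al * (pi / be)) * (x t0 + k) &
    forall px py, half_arc (x t0) px py <->
      exists2 t, t0 <= t <= t1 & px = x t /\ py = y t].
Proof.
move=> y0 xk; have y11 : -1 <= (1 : R) <= 1 by lra.
have HE : H (x t0) (y t0) = H (x t0) 1 by rewrite y0 first_integral_even.
have [||//||t1 [t01 yt1 xt1 tP]] := @strip_passage t0; [params_lra|by rewrite y0; lra| |].
  by rewrite HE; apply: first_integral_increasing => //; params_lra.
move: tP; rewrite HE => tP.
have xE : x t1 = x t0.
  have [|e1 _ H1] := tP t1; first by rewrite lexx ltW.
  by apply: (@first_integral_inj _ _ 1) => //; [params_lra|rewrite -H1 yt1].
have [yt2 xt2 sP] := top_turn yt1 xt1; rewrite xE in xt2 sP.
have pb : 0 < pi / be by rewrite divr_gt0 ?pi_gt0.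
exists (t1 + pi / be); split => //; first lra.
move=> px py; split.
- case=> [[e1 py1 HX]|[t tpi [-> ->]]].
    (* The trajectory takes every height in the strip, and at a given height and level there is only
       one abscissa beyond [e]. *)
    have [t tt yt] := @continuous_ivt R y t0 t1 py (ltW t01) (fun t _ => @cy t)
      ltac:(by rewrite y0 yt1).
    exists t; first lra; split => //.
    have [e2' _ H2] := tP t tt.
    by apply: (@first_integral_inj _ _ py) => //; rewrite HX -H2 yt.
  by exists (t1 + t); [lra|have [-> ->] := sP t tpi].
- move=> [t tt [-> ->]]; have [tt1|t1t] := leP t t1.
    by left; apply: tP; lra.
  right; exists (t - t1); first lra.
  by have := sP (t - t1); rewrite subrKC; apply; lra.
Qed.

End Trajectory.
(** Sorts the points of an arc by the open conditions that define the basin. Only the end point, on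
    the line to the left of the focus, escapes them; it is the start of the other half turn. *)
Lemma half_arc_region X px py : k' < X -> half_arc X px py ->
  [\/ 1 < py, [/\ e < px, -1 <= py <= 1 & H k' 1 < H px py] |
      px = - k - expR (al * (pi / be)) * (X + k) /\ py = 1].
Proof.
move=> kX; have y11 : -1 <= (1 : R) <= 1 by lra.
have HX : H k' 1 < H X 1 by apply: first_integral_increasing => //; params_lra.
case=> [[ex y1 HE]|[t /andP[t0 tb] [-> ->]]].
  by apply: Or32; split => //; rewrite HE.
move: t0; rewrite le_eqVlt => /orP[/eqP <-|t0].
  apply: Or32; rewrite /spiral_x /spiral_y !mulr0 expR0 cos0 sin0.
  have -> : 1 * (1 * (X + k) - 0) - k = X by ring.
  have -> : 1 * (0 * (X + k) + 0) + 1 = 1 :> R by ring.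
  by split => //; params_lra.
move: tb; rewrite le_eqVlt => /orP[/eqP ->|tb].
  apply: Or33; rewrite /spiral_x /spiral_y [be * _]mulrC divfK ?gt_eqF// cospi sinpi.
  by split; ring.
apply: Or31; rewrite /spiral_y mulr0 addr0 ltrDr mulr_gt0 ?expR_gt0// mulr_gt0//; last params_lra.
by apply: sin_gt0_pi; rewrite mulr_gt0//= mulrC -ltr_pdivlMr.
Qed.

End HalfTurn.

(** * Construction of a half turn *)

Section ContinuousAt.
Context {R : realType}.
Implicit Types (f g : R -> R) (t c : R).

Lemma cont_cst c t : {for t, continuous (fun=> c)}.
Proof. exact: cst_continuous. Qed.

Lemma cont_id t : {for t, continuous (fun s => s)}.
Proof. exact: cvg_id. Qed.

Lemma contD f g t : {for t, continuous f} -> {for t, continuous g} ->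
  {for t, continuous (fun s => f s + g s)}.
Proof. exact: continuousD. Qed.

Lemma contN f t : {for t, continuous f} -> {for t, continuous (fun s => - f s)}.
Proof. exact: continuousN. Qed.

Lemma contM f g t : {for t, continuous f} -> {for t, continuous g} ->
  {for t, continuous (fun s => f s * g s)}.
Proof. exact: continuousM. Qed.

Lemma contX2 f t : {for t, continuous f} -> {for t, continuous (fun s => f s ^+ 2)}.
Proof. by move=> cf; apply: contM. Qed.

Lemma contV f t : f t != 0 -> {for t, continuous f} ->
  {for t, continuous (fun s => (f s)^-1)}.
Proof. exact: continuousV. Qed.

Lemma continuous_squeeze f g t : {for t, continuous f} ->
  (forall s, `|g s - g t| <= `|f s - f t|) -> {for t, continuous g}.
Proof.
move=> cf gf; apply/cvgrPdist_lt => r r0.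
have [d d0 dP] := continuous_dist cf r0.
apply/nbhs_ballP; exists d => // s; rewrite /ball/= distrC => /dP fs.
by rewrite distrC; apply: le_lt_trans (gf s) fs.
Qed.

End ContinuousAt.

(** Separation of variables: [Y] inverts the time function [T], the primitive of [1 / v]. The upper
    bound [C] makes [T] grow at least linearly, so that [Y] is defined for all later times. *)
Lemma autonomous_ode {R : realType} (v : R -> R) (c C y0 : R) : continuous v ->
  0 < c -> (forall y, c <= v y <= C) ->
  exists (Y : R -> R) (d : R), [/\ 0 < d, Y 0 = y0 &
    forall t, - d < t -> is_derive t 1 Y (v (Y t))].
Proof.
move=> cv c0 vb; have v0 y : 0 < v y by case/andP: (vb y) => /(lt_le_trans c0).
have C0 : 0 < C by case/andP: (vb 0) => /(lt_le_trans c0) h /(lt_le_trans h).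
pose a := y0 - 1; pose w y := (v y)^-1.
have cw : continuous w by move=> y; apply: contV; [rewrite gt_eqF|exact: cv].
pose T (y : R) : R := (\int[lebesgue_measure]_(s in `[a, y]) w s)%R.
have dT y : a < y -> is_derive y 1 T (w y).
  move=> ay; have yy1 : y < y + 1 by rewrite ltrDl.
  have [|dT TE] := continuous_FTC1_closed yy1 _ ay (cw y).
    apply: continuous_compact_integrable; first exact: segment_compact.
    exact: continuous_subspaceT.
  by apply: DeriveDef; [exact: dT|rewrite -derive1E; exact: TE].
have Tlt y z : a < y -> y < z -> (z - y) / C <= T z - T y.
  move=> ay yz.
  have dT' s : y < s < z -> is_derive s 1 T (w s).
    by move=> /andP[ys _]; apply: dT; exact: lt_trans ys.
  have cT s : y <= s <= z -> {for s, continuous T}.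
    by move=> /andP[ys _]; apply: is_derive_continuous (dT s _); exact: lt_le_trans ys.
  have [s _ ->] := mean_value yz dT' cT.
  rewrite mulrC ler_wpM2r ?subr_ge0 ?(ltW yz)// /w lef_pV2 ?posrE//.
  by case/andP: (vb s).
have Tinc y z : a < y -> y < z -> T y < T z.
  move=> ay yz; rewrite -subr_gt0; apply: lt_le_trans (Tlt _ _ ay yz).
  by rewrite divr_gt0 ?subr_gt0.
(* A level strictly between the base point [a] of the integral and [y0]: the derivative of [T] is
   available near it, and starting the inverse at [T b] leaves room before time 0. *)
pose b := y0 - 2^-1; have ab : a < b by rewrite /a /b; lra.
have by0 : b < y0 by rewrite /b; lra.
have surj t : T b < t -> exists2 y, b < y & T y = t.
  move=> bt; pose z := b + C * (t - T b).
  have bz : b < z by rewrite ltrDl mulr_gt0 ?subr_gt0.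
  have Tz : t <= T z.
    have := Tlt _ _ ab bz; rewrite {1}/z addrC addKr mulrAC divff ?gt_eqF// mul1r.
    lra.
  have [||y /andP[by_ yz] Ty] := @continuous_ivt R T b z t (ltW bz).
  - by move=> s /andP[bs _]; apply: is_derive_continuous (dT s _); exact: lt_le_trans bs.
  - by rewrite Tz ltW.
  - exists y => //; rewrite lt_neqAle by_ andbT; apply/eqP => yb.
    by move: bt; rewrite yb Ty ltxx.
have [Y YP] : {Y : R -> R | forall t, T b < t -> b < Y t /\ T (Y t) = t}.
  apply: cid; have : forall t, exists y, T b < t -> b < y /\ T y = t.
    move=> t; have [/surj[y ? ?]|] := pselect (T b < t); first by exists y.
    by exists 0.
  by move=> /choice[Y YP]; exists Y.
have TK y : b < y -> Y (T y) = y.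
  move=> by_; have [bY TY] := YP _ (Tinc _ _ ab by_).
  have [lt|lt|//] := ltgtP (Y (T y)) y.
    by have := Tinc _ _ (lt_trans ab bY) lt; rewrite TY ltxx.
  by have := Tinc _ _ (lt_trans ab by_) lt; rewrite TY ltxx.
have dY t : T b < t -> is_derive t 1 Y (v (Y t)).
  move=> /YP[bY TY]; rewrite -{1}TY -[v _]invrK.
  have nb : \forall z \near Y t, b < z by exact: lt_nbhsr.
  apply: is_derive_inverse.
  - by near=> z; apply: TK; near: z.
  - near=> z; apply: (is_derive_continuous (dT z _)); apply: (lt_trans ab).
    by near: z.
  - by apply: dT; exact: lt_trans bY.
  - by rewrite invr_neq0// gt_eqF.
have Tb0 := Tinc _ _ ab by0.
exists (fun t => Y (t + T y0)), (T y0 - T b); split; first by rewrite subr_gt0.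
  by rewrite add0r TK.
move=> t td; rewrite -[X in is_derive _ _ _ X]mulr1.
apply: (is_derive1_comp (f := Y) (g := fun t => t + T y0)); first by apply: dY; lra.
by eapply is_derive_eq; [repeat derive_step|rewrite /= addr0].
Unshelve. all: by end_near. Qed.

(** * Concatenation and periodic extension of paths *)

Section Glue.
Context {R : realType}.
Implicit Types (f g : R -> R) (t K : R).

Definition glue (a : R) f g := fun t => if t <= a then f t else g (t - a).

Lemma glue_left a f g t : t <= a -> glue a f g t = f t.
Proof. by rewrite /glue => ->. Qed.

Lemma glue_right a f g t : f a = g 0 -> 0 <= t -> glue a f g (a + t) = g t.
Proof.
rewrite /glue => fg t0; case: ifP => [h|_]; last by congr g; ring.
have -> : t = 0 by lra.
by rewrite addr0.
Qed.

Lemma glue_lipschitz K a b f g : 0 <= a -> f a = g 0 ->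
  (forall s t, 0 <= s -> s <= t -> t <= a -> `|f t - f s| <= K * (t - s)) ->
  (forall s t, 0 <= s -> s <= t -> t <= b -> `|g t - g s| <= K * (t - s)) ->
  forall s t, 0 <= s -> s <= t -> t <= a + b ->
    `|glue a f g t - glue a f g s| <= K * (t - s).
Proof.
move=> a0 fg fK gK s t s0 st tb; rewrite /glue.
have [ta|at_] := leP t a; first by rewrite (le_trans st ta); exact: fK.
have [sa|as_] := leP s a; last first.
  have -> : t - s = (t - a) - (s - a) by ring.
  by apply: gK; lra.
have -> : g (t - a) - f s = (g (t - a) - g 0) + (f a - f s) by rewrite fg; ring.
apply: (le_trans (ler_normD _ _)).
have -> : K * (t - s) = K * (t - a - 0) + K * (a - s) by ring.
by apply: lerD; [apply: gK; lra|apply: fK].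
Qed.

Lemma is_derive_glue_left a f g t d : t < a -> is_derive t 1 f d ->
  is_derive t 1 (glue a f g) d.
Proof.
move=> ta; apply: near_eq_is_derive.
by near=> s; rewrite glue_left// ltW//; near: s; exact: lt_nbhsl.
Unshelve. all: by end_near. Qed.

Lemma is_derive_shift1 g a t d : is_derive (t - a) 1 g d ->
  is_derive t 1 (fun s => g (s - a)) d.
Proof.
move=> dg; rewrite -[X in is_derive _ _ _ X]mulr1.
apply: (is_derive1_comp (f := g) (g := fun s => s - a)) => //.
by eapply is_derive_eq; [repeat derive_step|rewrite /=; lra].
Qed.

Lemma is_derive_glue_right a f g t d : a < t -> is_derive (t - a) 1 g d ->
  is_derive t 1 (glue a f g) d.
Proof.
move=> at_ /is_derive_shift1; apply: near_eq_is_derive.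
by near=> s; rewrite /glue leNgt ifF//; apply/negbF; near: s; exact: lt_nbhsr.
Unshelve. all: by end_near. Qed.

Definition periodize (p : R) f := fun t => f (t - p * (Num.floor (t / p))%:~R).

Lemma periodize_rem p t : 0 < p -> 0 <= t - p * (Num.floor (t / p))%:~R < p.
Proof.
move=> p0; have /andP[h1 h2] := real_floor_itv (num_real (t / p)).
move: h1 h2; rewrite ler_pdivlMr// ltr_pdivrMr// intrD mulrDl mul1r.
by rewrite mulrC; lra.
Qed.

Lemma floor_eq_rem p (n : int) t : 0 < p -> 0 <= t - p * n%:~R < p ->
  Num.floor (t / p) = n.
Proof.
move=> p0 h; apply/floor_def; rewrite ler_pdivlMr// ltr_pdivrMr//.
by rewrite intrD mulrDl mul1r [_ * p]mulrC; lra.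
Qed.

Lemma periodizeD p f t : 0 < p -> periodize p f (t + p) = periodize p f t.
Proof.
move=> p0; rewrite /periodize.
rewrite (@floor_eq_rem p (Num.floor (t / p) + 1) (t + p))//.
  by rewrite intrD mulrDr mulr1; congr f; ring.
have := periodize_rem t p0; rewrite intrD mulrDr mulr1; lra.
Qed.

Lemma periodize_in p f t : 0 <= t < p -> periodize p f t = f t.
Proof.
move=> /andP[t0 tp]; have p0 := le_lt_trans t0 tp.
by rewrite /periodize (@floor_eq_rem p 0)// ?mulr0 subr0// t0.
Qed.

(** For times in different periods the increment is split at the common value [f p = f 0]; the two
    pieces together last at most [t - s]. *)
Lemma periodize_lipschitz K p f : 0 < p -> 0 <= K -> f p = f 0 ->
  (forall s t, 0 <= s -> s <= t -> t <= p -> `|f t - f s| <= K * (t - s)) ->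
  forall s t, s <= t -> `|periodize p f t - periodize p f s| <= K * (t - s).
Proof.
move=> p0 K0 fp fK s t st; rewrite /periodize.
have := periodize_rem s p0; have := periodize_rem t p0.
set n := Num.floor (t / p); set l := Num.floor (s / p).
have ln : l <= n by apply: le_floor; rewrite ler_pM2r// invr_gt0.
set u := t - _; set v := s - _ => ub vb.
move: ln; rewrite le_eqVlt => /orP[/eqP lnE|ln].
  have uv : t - s = u - v by rewrite /u /v lnE; ring.
  by rewrite uv; apply: fK; lra.
have ln1 : (l + 1)%:~R <= n%:~R :> R by rewrite ler_int lezD1.
have -> : f u - f v = (f u - f 0) + (f p - f v) by rewrite fp; ring.
apply: (le_trans (ler_normD _ _)).
apply: (@le_trans _ _ (K * (u - 0) + K * (p - v))).
  by apply: lerD; apply: fK; lra.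
rewrite -mulrDr ler_wpM2l//.
have : p * (l + 1)%:~R <= p * n%:~R by rewrite ler_pM2l.
by rewrite intrD /u /v; lra.
Qed.

Lemma is_derive_periodize p f (n : int) t d : 0 < t - p * n%:~R < p ->
  is_derive (t - p * n%:~R) 1 f d -> is_derive t 1 (periodize p f) d.
Proof.
move=> /andP[t0 tp] /is_derive_shift1; have p0 := lt_trans t0 tp.
apply: near_eq_is_derive; near=> s; rewrite /periodize.
rewrite (@floor_eq_rem p n s)//; apply/andP; split.
  apply: ltW; rewrite subr_gt0; near: s; apply: lt_nbhsr; lra.
rewrite ltrBlDr; near: s; apply: lt_nbhsl; lra.
Unshelve. all: by end_near. Qed.

End Glue.

(** * Projection onto the heights of the strip *)

Section Clamp.
Context {R : realType}.
Implicit Types y z : R.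

(** Extends data given on the strip to all heights, so that the equation for the height has a
    continuous right-hand side with global bounds. *)
Definition clamp y := Num.max (-1) (Num.min 1 y).

Lemma clamp_itv y : -1 <= clamp y <= 1.
Proof.
apply/andP; split; first by rewrite le_max lexx.
by rewrite ge_max ge_min lexx andbT (@le_trans _ _ 0) ?oppr_le0.
Qed.

Lemma clamp_id y : -1 <= y <= 1 -> clamp y = y.
Proof. by move=> /andP[h1 h2]; rewrite /clamp (min_idPr h2) (max_idPr h1). Qed.

Lemma clamp_dist y z : `|clamp z - clamp y| <= `|z - y|.
Proof.
have spec x : [\/ x <= -1 /\ clamp x = -1, -1 <= x <= 1 /\ clamp x = x |
    1 <= x /\ clamp x = 1].
  have [x1|x1] := leP x (-1).
    by apply: Or31; rewrite /clamp (min_idPr _) ?(max_idPl _)//; lra.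
  have [x2|x2] := leP 1 x; first by apply: Or33; rewrite /clamp (min_idPl _) ?(max_idPr _)//; lra.
  by apply: Or32; rewrite clamp_id; lra.
have := ler_norm (z - y); have := ler_norm (- (z - y)); rewrite normrN ler_norml.
by case: (spec y) => -[? ->]; case: (spec z) => -[? ->]; lra.
Qed.

Lemma clamp_continuous y : {for y, continuous clamp}.
Proof.
apply: (@continuous_squeeze R (fun z => z)); first exact: cont_id.
by move=> z; exact: clamp_dist.
Qed.

End Clamp.

Section FieldContinuity.
Context {R : realType}.
Variables (eps : R) (u w : R -> R) (y : R).
Hypotheses (cu : {for y, continuous u}) (cw : {for y, continuous w}).

Lemma cont_norm2 : {for y, continuous (fun z => u z ^+ 2 + w z ^+ 2)}.
Proof. by apply: contD; exact: contX2. Qed.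

Lemma cont_field_num_x : {for y, continuous (fun z => field_num_x eps (u z) (w z))}.
Proof.
apply: contM => //; apply: contD; first exact: cont_norm2.
by apply: contM => //; exact: cont_cst.
Qed.

Lemma cont_field_num_y : {for y, continuous (fun z => field_num_y eps (u z) (w z))}.
Proof.
apply: contD; first by apply: contM => //; exact: cont_norm2.
apply: contM; first exact: cont_cst.
by apply: contD; [exact: contX2|apply: contN; exact: contX2].
Qed.

Lemma cont_field_den : {for y, continuous (fun z => field_den eps (u z) (w z))}.
Proof.
apply: contD; last exact: contX2.
apply: contX2; apply: contD; first exact: cont_cst.
by apply: contM => //; exact: cont_cst.
Qed.

Lemma cont_field_x : field_den eps (u y) (w y) != 0 ->
  {for y, continuous (fun z => field_x eps (u z) (w z))}.
Proof.
move=> d0; apply: contM; first by apply: contN; exact: cont_field_num_x.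
apply: (@contV _ (fun z => field_den eps (u z) (w z))) => //; exact: cont_field_den.
Qed.

Lemma cont_field_y : field_den eps (u y) (w y) != 0 ->
  {for y, continuous (fun z => field_y eps (u z) (w z))}.
Proof.
move=> d0; apply: contM; first exact: cont_field_num_y.
apply: (@contV _ (fun z => field_den eps (u z) (w z))) => //; exact: cont_field_den.
Qed.

End FieldContinuity.

(** * Level curves of the first integral as graphs over the height *)

Section HalfPath.
Context {R : realType}.
Variables (al be k al' be' k' eps e m : R).
Implicit Types (a b x y z s t : R) (X : R -> R).
Local Notation H := (first_integral eps).
Local Notation fx := (field_x eps).
Local Notation fy := (field_y eps).
Hypothesis hp : half_params al be k al' be' k' eps e m.

Let eps1 : -1 <= eps <= 1. Proof. exact: hp_eps hp. Qed.
Let e2 : 2^-1 <= e. Proof. exact: hp_e hp. Qed.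
Let m0 : 0 < m. Proof. exact: hp_m hp. Qed.

Let Hx (x y : R) := field_num_y eps x y / (x ^+ 2 + y ^+ 2) ^+ 2.
Let Hy (x y : R) := field_num_x eps x y / (x ^+ 2 + y ^+ 2) ^+ 2.

Let r0 (x y : R) : e <= x -> 0 < x ^+ 2 + y ^+ 2.
Proof.
move=> ex; have x0 : 0 < x by have := e2; lra.
by have := sqr_ge0 y; have : 0 < x ^+ 2 := exprn_gt0 _ x0; lra.
Qed.

Let dHx (x y : R) : e <= x -> is_derive x 1 (fun s => H s y) (Hx x y).
Proof.
move=> ex; have := @is_derive_first_integral R eps id (cst y) x 1 0 (r0 y ex).
by rewrite mulr1 mulr0 addr0; apply.
Qed.

Let dHy (x y : R) : e <= x -> is_derive y 1 (fun s => H x s) (Hy x y).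
Proof.
move=> ex; have := @is_derive_first_integral R eps (cst x) id y 0 1 (r0 y ex).
by rewrite mulr1 mulr0 add0r; apply.
Qed.

Let incr := first_integral_increasing hp.

Lemma level_exists (h0 y : R) : H e y < h0 -> exists2 x, e < x & H x y = h0.
Proof.
(* Far enough to the right: the summand [expR (h0 + 1)] makes the logarithmic term at least
   [h0 + 1], and [1 <= x] keeps the subtracted fraction at most 1. *)
move=> He; pose x := expR (h0 + 1) + 1 + e.
have e0 : 0 < e by have := e2; lra.
have ex := expR_gt0 (h0 + 1).
have x1 : 1 <= x by rewrite /x; lra.
have exx : e <= x by rewrite /x; lra.
have Hxy : h0 <= H x y.
  have rx : x ^+ 2 <= x ^+ 2 + y ^+ 2 by rewrite lerDl sqr_ge0.
  have x20 : 0 < x ^+ 2 by rewrite exprn_gt0//; lra.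
  have lnx : h0 + 1 <= ln (x ^+ 2 + y ^+ 2) / 2.
    rewrite ler_pdivlMr// mulr_natr -[h0 + 1]expRK -lnXn// ler_ln ?posrE ?exprn_gt0//; last lra.
    apply: le_trans rx; rewrite lerXn2r ?nnegrE ?expR_ge0//; rewrite /x; lra.
  have : eps * x / (x ^+ 2 + y ^+ 2) <= 1.
    rewrite ler_pdivrMr ?mul1r; last exact: r0.
    have xx : x <= x ^+ 2 by rewrite expr2 ler_peMr//; lra.
    by have := eps1; nra.
  by rewrite /first_integral; lra.
have [s /andP[es _]||c /andP[ec _] Hc] := @continuous_ivt R (fun s => H s y) e x h0 exx.
- exact: is_derive_continuous (dHx y es).
- by rewrite (ltW He).
exists c => //; rewrite lt_neqAle ec andbT; apply/eqP => ce.
by move: He; rewrite ce Hc ltxx.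
Qed.

(** The level increases strictly in [x], so each height carries exactly one point. The slope
    [- Hy / Hx] of the graph equals [fx / fy], because the field is tangent to the level. *)
Lemma level_curve (h0 : R) : (forall y, -1 <= y <= 1 -> H e y < h0) ->
  exists X : R -> R, [/\ forall y, e < X y, forall y, H (X y) (clamp y) = h0,
    forall y, X (clamp y) = X y, continuous X &
    forall y, -1 < y < 1 -> is_derive y 1 X (fx (X y) y / fy (X y) y)].
Proof.
move=> He; have /choice[X0 X0P] : forall y, exists x, -1 <= y <= 1 -> e < x /\ H x y = h0.
  move=> y; have [/He/level_exists[x ? ?]|] := pselect (-1 <= y <= 1); first by exists x.
  by exists 0.
pose X y := X0 (clamp y).
have eX y : e < X y by case: (X0P (clamp y)) => //; exact: clamp_itv.
have HX y : H (X y) (clamp y) = h0 by case: (X0P (clamp y)) => //; exact: clamp_itv.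
have cX y : {for y, continuous X}.
  have cHcl x z : e <= x -> {for z, continuous (fun s => H x (clamp s))}.
    move=> ex; apply: (@continuous_comp _ _ _ clamp (fun s => H x s)).
      exact: clamp_continuous.
    exact: is_derive_continuous (dHy _ ex).
  apply/cvgrPdist_lt => r rgt0.
  (* Two abscissae around [X y], the left one kept beyond [e], whose levels are strictly on either
     side of [h0]. This persists at nearby heights and traps [X z] between them. *)
  pose x1 := Num.max (X y - r / 2) ((e + X y) / 2); pose x2 := X y + r / 2.
  have h1 : X y - r / 2 <= x1 by rewrite le_max lexx.
  have h2 : (e + X y) / 2 <= x1 by rewrite le_max lexx orbT.
  have ey := eX y.
  have x1y : x1 < X y by rewrite gt_max; apply/andP; split; lra.
  have ex1 : e < x1 by lra.
  have yx2 : X y < x2 by rewrite /x2; lra.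
  have ex2 : e <= x2 by lra.
  have H1 : H x1 (clamp y) < h0 by rewrite -(HX y); apply: incr => //; [lra|exact: clamp_itv].
  have H2 : h0 < H x2 (clamp y) by rewrite -(HX y); apply: incr => //; [lra|exact: clamp_itv].
  have [d1 d10 d1P] := continuous_lt (cHcl _ y (ltW ex1)) H1.
  have [d2 d20 d2P] := continuous_gt (cHcl _ y ex2) H2.
  apply/nbhs_ballP; exists (Num.min d1 d2); first by rewrite /= lt_min d10.
  move=> z; rewrite /ball/= distrC lt_min => /andP[/d1P z1 /d2P z2].
  have zx1 : x1 < X z.
    rewrite ltNge; apply/negP; rewrite le_eqVlt => /orP[/eqP zE|lt].
      by move: z1; rewrite -zE HX ltxx.
    have := incr (ltW (eX z)) lt (clamp_itv z); rewrite HX => /lt_trans/(_ z1).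
    by rewrite ltxx.
  have zx2 : X z < x2.
    rewrite ltNge; apply/negP; rewrite le_eqVlt => /orP[/eqP zE|lt].
      by move: z2; rewrite zE HX ltxx.
    have := incr ex2 lt (clamp_itv z); rewrite HX => /(lt_trans z2).
    by rewrite ltxx.
  by rewrite ltr_norml; apply/andP; split; rewrite /x2 in zx2; lra.
exists X; split => //; first by move=> y; rewrite /X clamp_id// clamp_itv.
move=> y y1; have y1' : -1 <= y <= 1 by lra.
have cly : clamp y = y by exact: clamp_id.
(* Secant form of the implicit function theorem. *)
have /choice[xi xiP] : forall z, exists c, [/\ e < c,
    `|c - X y| <= `|X z - X y| &
    H (X z) (clamp z) - H (X y) (clamp z) = Hx c (clamp z) * (X z - X y)].
  move=> z; have ez := eX z; have ey := eX y.
  have mv (a b : R) : e < a -> a < b -> exists2 c, a < c < b &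
      H b (clamp z) - H a (clamp z) = Hx c (clamp z) * (b - a).
    move=> ea ab; apply: (mean_value ab (f := fun s => H s (clamp z))) => s hs.
      by apply: dHx; lra.
    by apply: is_derive_continuous (dHx _ _); lra.
  have [lt|lt|->] := ltgtP (X z) (X y).
  - have [c hc cE] := mv _ _ ez lt; exists c; split; first lra.
      by rewrite !ltr0_norm; lra.
    by rewrite -opprB cE; ring.
  - have [c hc cE] := mv _ _ ey lt; exists c; split => //; first lra.
    by rewrite !gtr0_norm; lra.
  - by exists (X y); split => //; rewrite !subrr mulr0.
have /choice[et etP] : forall z, exists c, `|c - y| <= `|clamp z - y| /\
    H (X y) (clamp z) - H (X y) y = Hy (X y) c * (clamp z - y).
  move=> z; have ey := ltW (eX y).
  have mv (a b : R) : a < b -> exists2 c, a < c < b &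
      H (X y) b - H (X y) a = Hy (X y) c * (b - a).
    move=> ab; apply: (mean_value ab (f := fun s => H (X y) s)) => s hs.
      exact: dHy.
    exact: is_derive_continuous (dHy _ _).
  have [lt|lt|->] := ltgtP (clamp z) y.
  - have [c hc cE] := mv _ _ lt; exists c; split; first by rewrite !ltr0_norm; lra.
    by rewrite -opprB cE; ring.
  - have [c hc cE] := mv _ _ lt; exists c; split => //.
    by rewrite !gtr0_norm; lra.
  - by exists y; split => //; rewrite !subrr mulr0.
have xiy : xi y = X y.
  have [_ + _] := xiP y; rewrite subrr normr0 normr_le0 subr_eq0.
  by move/eqP.
have ety : et y = y.
  have [+ _] := etP y; rewrite cly subrr normr0 normr_le0 subr_eq0.
  by move/eqP.
have cxi : {for y, continuous xi}.
  apply: (continuous_squeeze (cX y)) => z; rewrite xiy.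
  by have [] := xiP z.
have cet : {for y, continuous et}.
  apply: (continuous_squeeze (@clamp_continuous R y)) => z; rewrite ety cly.
  by have [] := etP z.
have num0 z : 0 < field_num_y eps (xi z) (clamp z).
  have [ez _ _] := xiP z.
  by have [] := field_signs hp ez (clamp_itv z).
have rx z : 0 < xi z ^+ 2 + clamp z ^+ 2.
  by have [ez _ _] := xiP z; apply: r0; exact: ltW.
have Hx0 z : 0 < Hx (xi z) (clamp z) by rewrite divr_gt0// exprn_gt0.
(* The difference quotient of [clamp], continuous at [y] with value 1 because [y] is interior to the
   strip. *)
have [kk [kE ck ky]] : exists kk : R -> R, [/\ forall z, clamp z - clamp y = kk z * (z - y),
    {for y, continuous kk} & kk y = 1].
  apply/(is_derive1_caratheodory clamp y 1).
  apply: (near_eq_is_derive _ (is_derive1_id y)).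
  near=> s; rewrite clamp_id//; apply/andP; split; apply: ltW; near: s.
    by apply: lt_nbhsr; case/andP: y1.
  by apply: lt_nbhsl; case/andP: y1.
apply/is_derive1_caratheodory.
exists (fun z => - Hy (X y) (et z) / Hx (xi z) (clamp z) * kk z); split.
- move=> z /=; rewrite -[RHS]mulrA -kE cly.
  have [_ _ E1] := xiP z; have [_ E2] := etP z.
  have E3 : Hx (xi z) (clamp z) * (X z - X y) = - (Hy (X y) (et z) * (clamp z - y)).
    by have := HX y; rewrite cly -E1 -E2 HX => ->; ring.
  apply: (mulfI (x := Hx (xi z) (clamp z))); first by rewrite gt_eqF.
  by rewrite E3; field; rewrite gt_eqF.
- have ccl := @clamp_continuous R y.
  apply: contM => //; apply: contM.
    apply: contN; apply: contM.
      by apply: cont_field_num_x => //; exact: cont_cst.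
    apply: contV; first by rewrite sqrf_eq0 gt_eqF// r0// ltW.
    by apply: contX2; apply: cont_norm2 => //; exact: cont_cst.
  apply: contV; first by rewrite gt_eqF.
  apply: contM; first exact: cont_field_num_y.
  apply: contV; first by rewrite sqrf_eq0 gt_eqF.
  by apply: contX2; apply: cont_norm2.
- rewrite ky mulr1 xiy ety cly /Hx /Hy /field_x /field_y.
  have := num0 y; rewrite xiy cly => n0.
  have := field_signs hp (eX y) y1' => -[D0 _].
  have := r0 y (ltW (eX y)) => rr.
  by field; rewrite !gt_eqF.
Unshelve. all: by end_near. Qed.

End HalfPath.

(** * A half turn as an explicit Lipschitz path *)

Section HalfPathExists.
Context {R : realType}.
Variables (al be k al' be' k' eps e m : R).
Implicit Types (s t X : R).
Local Notation H := (first_integral eps).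
Local Notation fx := (field_x eps).
Local Notation fy := (field_y eps).
Hypothesis hp : half_params al be k al' be' k' eps e m.

(** The lines have no clause: a half turn meets them only at its two ends and when it leaves the
    strip, and no velocity is prescribed at these instants. *)
Definition arc_velocity (x y vx vy : R) : Prop :=
  [/\ -1 < y < 1, e < x, vx = fx x y & vy = fy x y] \/
  [/\ 1 < y, vx = al * (x + k) - be * (y - 1) & vy = be * (x + k) + al * (y - 1)].

(** The path leaves the strip at time [p], where it may have a corner. [path_in] serves to keep it
    away from the pole, and the Lipschitz bounds survive gluing and give absolute continuity. *)
Record half_path X (p T K : R) (x y : R -> R) : Prop := HalfPath {
  path_switch : 0 < p < T; path_lip0 : 0 <= K;
  path_x0 : x 0 = X; path_y0 : y 0 = -1;
  path_xT : x T = - k - expR (al * (pi / be)) * (X + k); path_yT : y T = 1;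
  path_lip : forall s t, 0 <= s -> s <= t -> t <= T ->
    `|x t - x s| <= K * (t - s) /\ `|y t - y s| <= K * (t - s);
  path_in : forall t, 0 <= t <= T -> e < x t /\ -1 <= y t <= 1 \/ 1 <= y t;
  path_vel : forall t, 0 < t < T -> t != p -> exists vx vy,
    [/\ is_derive t 1 x vx, is_derive t 1 y vy & arc_velocity (x t) (y t) vx vy] }.

(** Only the height is solved for, from [Y' = fy (F Y) Y] along the level curve [x = F y]; then
    [F Y] has derivative [(fx / fy) fy = fx] by the chain rule. The spiral is appended at the time
    [p] when [Y] reaches 1. *)
Lemma half_path_exists X : k' < X -> exists p T K x y, half_path X p T K x y.
Proof.
move=> kX; have [al0 be0 _ _ eps1 e2 ek' k0 m0 fy_ge He] := hp.
have eX : e < X := lt_trans ek' kX.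
have y11 : -1 <= (1 : R) <= 1 by lra.
have yN1 : -1 <= (-1 : R) <= 1 by lra.
have [|F [eF HF Fcl cF dF]] := @level_curve _ _ _ _ _ _ _ _ _ _ hp (H X 1).
  move=> y hy; apply: lt_trans (He _ hy) _.
  by apply: (first_integral_increasing hp) => //; exact: ltW.
have F1 : F 1 = X.
  by apply: (first_integral_inj hp (eF 1) eX y11); have := HF 1; rewrite clamp_id.
have FN1 : F (-1) = X.
  apply: (first_integral_inj hp (eF (-1)) eX yN1); have := HF (-1).
  by rewrite clamp_id// => ->; rewrite first_integral_even.
pose v (y : R) := fy (F y) (clamp y).
have D0 (y : R) : field_den eps (F y) (clamp y) != 0.
  by have [h _] := field_signs hp (eF y) (clamp_itv y); rewrite gt_eqF.
have cv : continuous v.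
  move=> y; apply: cont_field_y; [exact: cF|exact: clamp_continuous|exact: D0].
have [C C0 CP] : exists2 C : R, 0 <= C & forall y, v y <= C.
  have [C C0 CP] := continuous_bounded (f := v) (a := -1) (b := 1) ltac:(lra) (fun y _ => cv y).
  exists C => // y; apply: le_trans (ler_norm _) _.
  have -> : v y = v (clamp y) by rewrite /v Fcl (clamp_id (clamp_itv y)).
  by apply: CP; exact: clamp_itv.
have vb (y : R) : m <= v y <= C by rewrite CP andbT; apply: fy_ge; [exact: eF|exact: clamp_itv].
have [Y [d [d0 Y0 dY]]] := autonomous_ode (-1) cv m0 vb.
have dY' t : 0 <= t -> is_derive t 1 Y (v (Y t)) by move=> t0; apply: dY; lra.
have cY t : 0 <= t -> {for t, continuous Y}.
  by move=> /dY'/is_derive_continuous.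
have Yinc (s t : R) : 0 <= s -> s < t -> m * (t - s) <= Y t - Y s.
  move=> s0 st.
  have h1 r : s < r < t -> is_derive r 1 Y (v (Y r)) by move=> hr; apply: dY'; lra.
  have h2 r : s <= r <= t -> {for r, continuous Y} by move=> hr; apply: cY; lra.
  have [r hr ->] := mean_value st h1 h2.
  by rewrite ler_wpM2r ?subr_ge0 ?(ltW st)//; case/andP: (vb (Y r)).
have Ylt s t : 0 <= s -> s < t -> Y s < Y t.
  by move=> s0 st; have := Yinc _ _ s0 st; have : 0 < m * (t - s);
    [rewrite mulr_gt0 ?subr_gt0|lra].
have m20 : 0 < 2 / m by rewrite divr_gt0.
have [p /andP[p0 _] Yp] : exists2 p, 0 <= p <= 2 / m & Y p = 1.
  apply: continuous_ivt; [exact: ltW|by move=> s /andP[/cY]|].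
  have := Yinc _ _ (lexx 0) m20; rewrite subr0 mulrC divfK ?gt_eqF// Y0; lra.
have {}p0 : 0 < p.
  rewrite lt_neqAle p0 andbT; apply/eqP => p0E.
  by move: Yp; rewrite -p0E Y0; lra.
have Yin t : 0 <= t <= p -> -1 <= Y t <= 1.
  move=> /andP[t0 tp]; rewrite -Y0 -Yp; apply/andP; split.
    by move: t0; rewrite le_eqVlt => /orP[/eqP <-//|/(Ylt _ _ (lexx 0))/ltW].
  by move: tp; rewrite le_eqVlt => /orP[/eqP ->//|/(Ylt _ _ t0)/ltW].
have Yoo t : 0 < t < p -> -1 < Y t < 1.
  move=> /andP[t0 tp]; have := Ylt _ _ (lexx 0) t0; have := Ylt _ _ (ltW t0) tp.
  by rewrite Y0 Yp => -> ->.
have dFY t : 0 < t < p -> is_derive t 1 (fun t => F (Y t)) (fx (F (Y t)) (clamp (Y t))).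
  move=> tp; have t0 : 0 <= t by lra.
  have Yt := Yoo t tp; have Yt' : -1 <= Y t <= 1 by lra.
  apply: (is_derive_eq (is_derive1_comp (dF _ Yt) (dY' t t0))).
  rewrite /v clamp_id// divfK// gt_eqF// (lt_le_trans m0)//; exact: fy_ge.
have cFY t : 0 <= t -> {for t, continuous (fun t => F (Y t))}.
  by move=> t0; apply: continuous_comp; [exact: cY|exact: cF].
have [K1 K10 K1P] : exists2 K1 : R, 0 <= K1 & forall t, 0 <= t <= p ->
    `|fx (F (Y t)) (clamp (Y t))| <= K1.
  apply: continuous_bounded (ltW p0) _ => t /andP[t0 _].
  apply: cont_field_x; [exact: cFY| |exact: D0].
  by apply: (@continuous_comp _ _ _ Y clamp); [exact: cY|exact: clamp_continuous].
have [K2 K20 K2P] := spiral_lipschitz be al0 (X + k) 0.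
pose K := K1 + C + K2.
have KE s t (K' : R) : s <= t -> K' <= K -> K' * (t - s) <= K * (t - s).
  by move=> st KK; rewrite ler_wpM2r// subr_ge0.
have pb : 0 < pi / be by rewrite divr_gt0 ?pi_gt0.
pose gx t := spiral_x al be (X + k) 0 t - k; pose gy t := spiral_y al be (X + k) 0 t + 1.
have gx0 : gx 0 = X by rewrite /gx /spiral_x !mulr0 expR0 cos0; ring.
have gy0 : gy 0 = 1 by rewrite /gy /spiral_y !mulr0 expR0 sin0; ring.
have jx : F (Y p) = gx 0 by rewrite Yp F1 gx0.
have jy : Y p = gy 0 by rewrite Yp gy0.
have lipFY s t : 0 <= s -> s <= t -> t <= p -> `|F (Y t) - F (Y s)| <= K * (t - s).
  move=> s0 st tp; apply: (@le_trans _ _ (K1 * (t - s))); last first.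
    by apply: KE => //; rewrite /K; lra.
  apply: (bounded_derive_lipschitz (f := fun t => F (Y t)) dFY) s0 st tp.
    by move=> r /andP[r0 _]; exact: cFY.
  by move=> r hr; apply: K1P; lra.
have lipY s t : 0 <= s -> s <= t -> t <= p -> `|Y t - Y s| <= K * (t - s).
  move=> s0 st tp; apply: (@le_trans _ _ (C * (t - s))); last first.
    by apply: KE => //; rewrite /K; lra.
  have h1 r : 0 < r < p -> is_derive r 1 Y (v (Y r)) by move=> hr; apply: dY'; lra.
  apply: (bounded_derive_lipschitz h1) s0 st tp.
    by move=> r /andP[r0 _]; exact: cY.
  by move=> r hr; case/andP: (vb (Y r)) => h2 h3; rewrite ger0_norm // (le_trans (ltW m0)).
have lipg s t : 0 <= s -> s <= t -> `|gx t - gx s| <= K * (t - s) /\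
    `|gy t - gy s| <= K * (t - s).
  move=> s0 st; have [h1 h2] := K2P _ _ s0 st.
  have KK : K2 * (t - s) <= K * (t - s) by apply: KE => //; rewrite /K; lra.
  rewrite /gx /gy; split.
    by rewrite opprD opprK addrACA addNr addr0 (le_trans h1).
  by rewrite opprD addrACA subrr addr0 (le_trans h2).
have gy1 t : 0 < t < pi / be -> 1 < gy t.
  move=> /andP[t0 tb]; rewrite /gy ltrDr /spiral_y mulr0 addr0.
  rewrite mulr_gt0 ?expR_gt0// mulr_gt0//; last lra.
  by apply: sin_gt0_pi; rewrite mulr_gt0//= mulrC -ltr_pdivlMr.
have gyT : gy (pi / be) = 1.
  by rewrite /gy /spiral_y [be * _]mulrC divfK ?gt_eqF// sinpi mul0r mulr0 addr0 mulr0 add0r.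
exists p, (p + pi / be), K, (glue p (fun t => F (Y t)) gx), (glue p Y gy); split.
- by rewrite p0 ltrDl.
- by rewrite /K; lra.
- by rewrite glue_left ?Y0 ?FN1// ltW.
- by rewrite glue_left// ltW.
- rewrite glue_right ?(ltW pb)// /gx /spiral_x [be * _]mulrC divfK ?gt_eqF// cospi sinpi.
  by ring.
- by rewrite glue_right// ltW.
- move=> s t s0 st tT; split; apply: (glue_lipschitz (b := pi / be)) s0 st tT => //.
  + exact: ltW.
  + by move=> r r' r0 rr' _; case: (lipg r r').
  + exact: ltW.
  + by move=> r r' r0 rr' _; case: (lipg r r').
- move=> t /andP[t0 tT]; have [tp|pt] := leP t p.
    by left; rewrite !glue_left//; split; [exact: eF|apply: Yin; rewrite t0].
  right; have -> : t = p + (t - p) by ring.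
  rewrite glue_right//; last lra.
  have [tpE|tpN] := eqVneq (t - p) (pi / be); first by rewrite tpE gyT.
  apply/ltW/gy1; rewrite subr_gt0 pt/= lt_neqAle tpN/=; lra.
- move=> t /andP[t0 tT]; rewrite neq_lt => /orP[tp|pt].
    have tt : 0 < t < p by rewrite t0.
    have Yt := Yoo t tt; have Yt' : -1 <= Y t <= 1 by lra.
    exists (fx (F (Y t)) (Y t)), (fy (F (Y t)) (Y t)); split.
    + apply: is_derive_glue_left => //; have := dFY t tt.
      by rewrite clamp_id.
    + apply: is_derive_glue_left => //; have := dY' t (ltW t0).
      by rewrite /v clamp_id.
    + by left; rewrite !glue_left ?(ltW tp).
  have tpE : t = p + (t - p) by ring.
  have tp0 : 0 <= t - p by lra.
  have xE : glue p (fun t => F (Y t)) gx t = gx (t - p) by rewrite {1}tpE glue_right.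
  have yE : glue p Y gy t = gy (t - p) by rewrite {1}tpE glue_right.
  exists (al * (gx (t - p) + k) - be * (gy (t - p) - 1)),
    (be * (gx (t - p) + k) + al * (gy (t - p) - 1)); split.
  + apply: is_derive_glue_right => //; rewrite /gx /gy.
    apply: (is_derive_eq (is_derive1D (is_derive_spiral_x al be (X + k) 0 (t - p))
      (is_derive1_cst (- k) _))); ring.
  + apply: is_derive_glue_right => //; rewrite /gx /gy.
    apply: (is_derive_eq (is_derive1D (is_derive_spiral_y al be (X + k) 0 (t - p))
      (is_derive1_cst 1 _))); ring.
  + by right; rewrite xE yE; split => //; apply: gy1; lra.
Qed.

End HalfPathExists.

(** * The two halves of the cycle *)

Section CycleParameters.
Context {R : realType}.
Implicit Types (x y : R).

(* The point -1.36 + i is just outside the separatrix through the pole -1: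
   the claim is [ln 2.8496 / 2 + 1.36 / 2.8496 > 1], checked by squaring the bound
   [expR (- q / 2 ^ 9) >= 1 - q / 2 ^ 9] nine times. *)
Lemma first_integral_136 : 1 < first_integral (-1 : R) (136 / 100) 1.
Proof.
have sq (u r s : R) : 0 <= r -> s <= r ^+ 2 -> r <= expR u -> s <= expR (2 * u).
  move=> r0 sr ru; apply: (le_trans sr); rewrite expRM_natl.
  by rewrite lerXn2r ?nnegrE ?expR_ge0.
(* A lower estimate of [ln 2.8496] for which [q / 2] and the lower bound 0.477258 of [1.36 / 2.8496]
   still add up to more than 1. The bounds below are those for [expR (- q / 2^j)], rounded down at
   each squaring. *)
pose q : R := (104 + 549 / 1000) / 100.
have e0 : ((997 + 958 / 1000) / 1000) <= expR (- (q / 512)).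
  by apply: le_trans (expR_ge1Dx _); rewrite /q; lra.
have {e0}e1 := sq _ ((997 + 958 / 1000) / 1000) ((995 + 920 / 1000) / 1000) ltac:(lra) ltac:(lra) e0.
have {e1}e2 := sq _ ((995 + 920 / 1000) / 1000) ((991 + 856 / 1000) / 1000) ltac:(lra) ltac:(lra) e1.
have {e2}e3 := sq _ ((991 + 856 / 1000) / 1000) ((983 + 778 / 1000) / 1000) ltac:(lra) ltac:(lra) e2.
have {e3}e4 := sq _ ((983 + 778 / 1000) / 1000) ((967 + 819 / 1000) / 1000) ltac:(lra) ltac:(lra) e3.
have {e4}e5 := sq _ ((967 + 819 / 1000) / 1000) ((936 + 673 / 1000) / 1000) ltac:(lra) ltac:(lra) e4.
have {e5}e6 := sq _ ((936 + 673 / 1000) / 1000) ((877 + 356 / 1000) / 1000) ltac:(lra) ltac:(lra) e5.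
have {e6}e7 := sq _ ((877 + 356 / 1000) / 1000) ((769 + 753 / 1000) / 1000) ltac:(lra) ltac:(lra) e6.
have {e7}e8 := sq _ ((769 + 753 / 1000) / 1000) ((592 + 519 / 1000) / 1000) ltac:(lra) ltac:(lra) e7.
have {e8}e9 := sq _ ((592 + 519 / 1000) / 1000) ((351 + 78 / 1000) / 1000) ltac:(lra) ltac:(lra) e8.
have {e9} : ((351 + 78 / 1000) / 1000) <= expR (- q).
  suff -> : - q = 2 * (2 * (2 * (2 * (2 * (2 * (2 * (2 * (2 * - (q / 512))))))))) by [].
  by rewrite /q; lra.
rewrite expRN -[(expR q)^-1]mul1r ler_pdivlMr ?expR_gt0// => h.
have qE : expR q <= (284 + 96 / 100) / 100 by lra.
have lnq : q <= ln ((284 + 96 / 100) / 100).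
  have p0 : 0 < (284 + 96 / 100) / 100 :> R by lra.
  by rewrite -[X in X <= _]expRK ler_ln ?posrE ?expR_gt0.
have kE : (136 / 100) ^+ 2 + 1 ^+ 2 = (284 + 96 / 100) / 100 :> R by lra.
have : (477 + 258 / 1000) / 1000 <= 136 / 100 / ((136 / 100) ^+ 2 + 1 ^+ 2) :> R.
  by rewrite ler_pdivlMr; lra.
by move: lnq; rewrite /first_integral kE mulN1r mulNr /q; lra.
Qed.

(** The tight place is the corner [x = 11/20], [y^2 = 1]: there the numerator [x^3 + x^2 + x - 1] is
    0.018875 and the denominator 3.4025, with quotient about 0.0055. *)
Lemma field_y_right x y : 11 / 20 < x -> -1 <= y <= 1 -> 200^-1 <= field_y 1 x y.
Proof.
move=> x1 /andP[y1 y2].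
have D0 : 0 < field_den 1 x y.
  by rewrite /field_den ltr_wpDr ?sqr_ge0// exprn_gt0//; lra.
rewrite /field_y ler_pdivlMr// /field_den /field_num_y.
have s0 : 0 <= y ^+ 2 := sqr_ge0 y.
have s1 : y ^+ 2 <= 1 by have : 0 <= (1 - y) * (1 + y) by [apply: mulr_ge0; lra]; lra.
set s := y ^+ 2 in s0 s1 *; pose t := x - 11 / 20.
have t0 : 0 < t by rewrite subr_gt0.
have -> : x = t + 11 / 20 by rewrite /t; ring.
have t2 : 0 < t ^+ 2 := exprn_gt0 _ t0.
have t3 : 0 < t ^+ 3 := exprn_gt0 _ t0.
have ts : 0 <= t * s by rewrite mulr_ge0// ltW.
lra.
Qed.

(** With [t = x - 1] and [s = y^2], the numerator minus twice the denominator is [t^3 + t + t s];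
    the factor 2 is the one that cancels the terms [t^2] and [s]. *)
Lemma field_y_left x y : 1 < x -> -1 <= y <= 1 -> 2 <= field_y (-1) x y.
Proof.
move=> x1 _; have D0 : 0 < field_den (-1) x y.
  by rewrite /field_den mulN1r ltr_wpDr ?sqr_ge0// exprn_even_gt0//= ; lra.
rewrite /field_y ler_pdivlMr// /field_den /field_num_y.
have s0 : 0 <= y ^+ 2 := sqr_ge0 y.
set s := y ^+ 2 in s0 *; pose t := x - 1.
have t0 : 0 < t by rewrite subr_gt0.
have -> : x = t + 1 by rewrite /t; ring.
have t3 : 0 < t ^+ 3 := exprn_gt0 _ t0.
have ts : 0 <= t * s by rewrite mulr_ge0// ltW.
lra.
Qed.

Variables (a b c d x0 x1 : R).
Hypotheses (ha : a < 0) (hc : c < 0) (hb : 0 < b) (hd : 0 < d)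
  (hx0 : 55 / 100 < x0) (hx1 : 136 / 100 < x1).

(** On the edge [x = 11/20] both terms of the first integral increase with [y^2], so the level is
    largest on the lines, where it increases further up to [x0]. *)
Lemma half_params_right : half_params a b x1 c d x0 1 (11 / 20) 200^-1.
Proof.
split; rewrite ?invr_gt0//; try (move: hx0 hx1 => ? ?; lra); first exact: field_y_right.
move=> y /andP[y1 y2].
have s1 : y ^+ 2 <= 1 by have : 0 <= (1 - y) * (1 + y) by [apply: mulr_ge0; lra]; lra.
have s0 := sqr_ge0 y.
apply: (@le_lt_trans _ _ (first_integral 1 (11 / 20) 1)).
  rewrite /first_integral; apply: lerB.
    by rewrite ler_pM2r ?invr_gt0// ler_ln ?posrE; lra.
  by apply: ler_wpM2l; [lra|rewrite lef_pV2 ?posrE; lra].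
apply: (first_integral_increasing_num (e := 11 / 20)) => //; last by move: hx0; lra.
move=> x hx; have := field_y_right hx (y := 1) ltac:(lra).
have D0 : 0 < field_den 1 x 1 by rewrite /field_den ltr_wpDr ?sqr_ge0// exprn_gt0//; lra.
rewrite /field_y ler_pdivlMr// => /(lt_le_trans _); apply.
by rewrite mulr_gt0 ?invr_gt0.
Qed.

(** In the rotated plane the edge [x = 1] passes through the pole. With [s = y^2] the level on it is
    [ln (1 + s) / 2 + 1 / (1 + s)], at most [s / 2 + (1 - s / 2) = 1], the value at the pole. *)
Lemma half_params_left : half_params c d x0 a b x1 (-1) 1 2.
Proof.
split => //; try (move: hx0 hx1 => ? ?; lra); first exact: field_y_left.
move=> y /andP[y1 y2].
have s1 : y ^+ 2 <= 1 by have : 0 <= (1 - y) * (1 + y) by [apply: mulr_ge0; lra]; lra.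
have s0 := sqr_ge0 y.
apply: (@le_lt_trans _ _ 1).
  rewrite /first_integral expr1n; set s := y ^+ 2 in s0 s1 *.
  have ls : ln (1 + s) <= s by apply: le_ln1Dx; lra.
  have ss : 0 <= (1 - s) * s by rewrite mulr_ge0//; lra.
  have si : 1 / (1 + s) <= 1 - s / 2 by rewrite ler_pdivrMr; lra.
  rewrite mulr1 mulNr opprK; lra.
apply: (lt_trans first_integral_136).
apply: (first_integral_increasing_num (e := 1)) => //; last lra.
move=> x hx; have := field_y_left hx (y := 1) ltac:(lra).
have D0 : 0 < field_den (-1) x 1.
  by rewrite /field_den mulN1r ltr_wpDl ?sqr_ge0// expr1n.
rewrite /field_y ler_pdivlMr// => /(lt_le_trans _); apply.
by rewrite mulr_gt0.
Qed.

End CycleParameters.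

Lemma convex_gt0 {R : realType} (l u v : R) :
  0 <= l <= 1 -> 0 < u -> 0 < v -> 0 < l * u + (1 - l) * v.
Proof.
move=> /andP[l0 l1] u0 v0; have [->|lN1] := eqVneq l 1; first lra.
apply: ltr_wpDl; first by rewrite mulr_ge0// ltW.
by rewrite mulr_gt0// subr_gt0 lt_neqAle lN1.
Qed.

(** * Filippov vectors in real coordinates *)

Section ComplexFields.
Context {R : realType}.
Variables (a b c d x0 x1 : R).
Implicit Types (z v : R[i]) (x y : R).
Local Notation Re := complex.Re.
Local Notation Im := complex.Im.

Local Notation upper := (fun z : R[i] => (a +i* b) * (z - 'i%C + x1%:C)).
Local Notation center := (fun z : R[i] => 'i%C * z ^+ 2 / (1 + z)).
Local Notation lower := (fun z : R[i] => (c +i* d) * (z + 'i%C - x0%:C)).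

Lemma upper_coords z : upper z =
  (a * (Re z + x1) - b * (Im z - 1)) +i* (b * (Re z + x1) + a * (Im z - 1)).
Proof. by case: z => x y; apply/eqP; rewrite eq_complex /=; apply/andP; split; apply/eqP; ring. Qed.

Lemma lower_coords z : lower z =
  (c * (Re z - x0) - d * (Im z + 1)) +i* (d * (Re z - x0) + c * (Im z + 1)).
Proof. by case: z => x y; apply/eqP; rewrite eq_complex /=; apply/andP; split; apply/eqP; ring. Qed.

Lemma center_coords z : center z = field_x 1 (Re z) (Im z) +i* field_y 1 (Re z) (Im z).
Proof.
case: z => x y; apply/eqP; rewrite eq_complex expr2 /= /field_x /field_y
  /field_num_x /field_num_y /field_den.
have -> : (0 + y : R) = y by ring.
rewrite !mul1r; set D := ((1 + x) ^+ 2 + y ^+ 2)^-1; clearbody D.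
by apply/andP; split; apply/eqP; ring.
Qed.

Lemma field_x_opp x y : field_x (-1) (- x) (- y) = - field_x 1 x y.
Proof. by rewrite /field_x /field_num_x /field_den !mulN1r !mul1r !sqrrN opprK; ring. Qed.

Lemma field_y_opp x y : field_y (-1) (- x) (- y) = - field_y 1 x y.
Proof. by rewrite /field_y /field_num_y /field_den !mulN1r !mul1r !sqrrN opprK; ring. Qed.

Hypotheses (hpR : half_params a b x1 c d x0 1 (11 / 20) 200^-1)
  (hpL : half_params c d x0 a b x1 (-1) 1 2).

(** On a line beyond the threshold both adjacent fields have vertical components of the same sign,
    hence so has every convex combination. On the rest of the line, where sliding or escape may
    occur, nothing is claimed. *)
Lemma filippov_half z v : filippov upper center lower z v ->
  half_velocity a b x1 c d x0 1 (Re z) (Im z) (Re v) (Im v) /\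
  half_velocity c d x0 a b x1 (-1) (- Re z) (- Im z) (- Re v) (- Im v).
Proof.
have [a0 b0 c0 d0 _ eR kR' kR _ fR _] := hpR; have [_ _ _ _ _ eL kL' kL _ fL _] := hpL.
have no (P Q : Prop) : ~ P -> P -> Q by [].
case=> [[[z1 vE]|[z1 vE]|[z1 vE]]|[[z1 [l l01 vE]]|[z1 [l l01 vE]]]].
- rewrite vE upper_coords /=; split; split => //=.
  + by apply: no; lra.
  + by apply: no; lra.
  + by apply: no; case; lra.
  + by apply: no; lra.
  + by apply: no; lra.
  + by move=> _; ring.
  + by apply: no; case; lra.
- rewrite vE center_coords /=; move: z1; rewrite ltr_norml => z1; split; split => //=.
  + by apply: no; lra.
  + by apply: no; lra.
  + by apply: no; case; lra.
  + by apply: no; lra.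
  + by rewrite field_x_opp field_y_opp.
  + by apply: no; lra.
  + by apply: no; case; lra.
- rewrite vE lower_coords /=; split; split => //=.
  + by apply: no; lra.
  + by apply: no; lra.
  + by apply: no; case; lra.
  + by move=> _; split; ring.
  + by apply: no; lra.
  + by apply: no; lra.
  + by apply: no; case; lra.
- have y1 : -1 <= Im z <= 1 by rewrite z1 lexx andbT lerNl; lra.
  have vyE : Im v = l * (b * (Re z + x1)) + (1 - l) * field_y 1 (Re z) (Im z).
    by rewrite vE upper_coords center_coords z1 /=; ring.
  split; split.
  + by apply: no; lra.
  + by apply: no; lra.
  + by apply: no; lra.
  + move=> _ hx; rewrite vyE; apply: convex_gt0 => //.
      by rewrite mulr_gt0// addr_gt0// (lt_trans _ hx).
    by apply: lt_le_trans (fR _ _ (lt_trans kR' hx) y1); rewrite invr_gt0.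
  + by apply: no; lra.
  + by apply: no; lra.
  + by apply: no; lra.
  + move=> _ hx; have -> : - Im v = l * (b * (- Re z - x1))
        + (1 - l) * field_y (-1) (- Re z) (- Im z) by rewrite vyE field_y_opp; ring.
    apply: convex_gt0 => //; first by rewrite mulr_gt0// subr_gt0.
    have y1' : -1 <= - Im z <= 1 by rewrite z1 lexx/=; lra.
    exact: lt_le_trans (fL _ _ (lt_trans kL' hx) y1').
- have y1 : -1 <= Im z <= 1 by rewrite z1 lexx/=; lra.
  have vyE : Im v = l * field_y 1 (Re z) (Im z) + (1 - l) * (d * (Re z - x0)).
    by rewrite vE lower_coords center_coords z1 /=; ring.
  split; split.
  + by apply: no; lra.
  + by apply: no; lra.
  + by apply: no; lra.
  + move=> _ hx; rewrite vyE; apply: convex_gt0 => //.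
      by apply: lt_le_trans (fR _ _ (lt_trans kR' hx) y1); rewrite invr_gt0.
    by rewrite mulr_gt0// subr_gt0.
  + by apply: no; lra.
  + by apply: no; lra.
  + by apply: no; lra.
  + move=> _ hx; have -> : - Im v = l * field_y (-1) (- Re z) (- Im z)
        + (1 - l) * (d * (- Re z + x0)) by rewrite vyE field_y_opp; ring.
    apply: convex_gt0 => //; last by rewrite mulr_gt0// addr_gt0// (lt_trans _ hx).
    have y1' : -1 <= - Im z <= 1 by rewrite z1 opprK lexx andbT; lra.
    exact: lt_le_trans (fL _ _ (lt_trans kL' hx) y1').
Qed.

Lemma arc_filippov_right z (vx vy : R) :
  arc_velocity a b x1 1 (11 / 20) (Re z) (Im z) vx vy ->
  filippov upper center lower z (vx +i* vy).
Proof.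
case=> [[z1 _ -> ->]|[z1 -> ->]]; left.
  by apply: Or32; rewrite center_coords ltr_norml.
by apply: Or31; rewrite upper_coords.
Qed.

Lemma arc_filippov_left z (vx vy : R) :
  arc_velocity c d x0 (-1) 1 (- Re z) (- Im z) vx vy ->
  filippov upper center lower z ((- vx) +i* (- vy)).
Proof.
case=> [[z1 _ -> ->]|[z1 -> ->]]; left.
  by apply: Or32; rewrite center_coords field_x_opp field_y_opp !opprK ltr_norml; split => //; lra.
apply: Or33; rewrite lower_coords; split; first lra.
by apply/eqP; rewrite eq_complex /=; apply/andP; split; apply/eqP; ring.
Qed.

End ComplexFields.

(** * The return map *)

Section Dynamics.
Context {R : realType}.
Variables (a b c d x0 x1 : R).
Implicit Types (z v : R[i]) (g : R -> R[i]) (x y t X : R).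
Local Notation Re := complex.Re.
Local Notation Im := complex.Im.

Local Notation F := (filippov (fun z : R[i] => (a +i* b) * (z - 'i%C + x1%:C))
  (fun z : R[i] => 'i%C * z ^+ 2 / (1 + z))
  (fun z : R[i] => (c +i* d) * (z + 'i%C - x0%:C))).

Hypotheses (hpR : half_params a b x1 c d x0 1 (11 / 20) 200^-1)
  (hpL : half_params c d x0 a b x1 (-1) 1 2).

Lemma solution_half (D : set R[i]) g : solution D F g ->
  half_solution a b x1 c d x0 1 (fun t => Re (g t)) (fun t => Im (g t)) /\
  half_solution c d x0 a b x1 (-1) (fun t => - Re (g t)) (fun t => - Im (g t)).
Proof.
move=> [_ acx acy ode]; split; split => //.
- apply: ae_lebesgueS ode => t [v [dx dy] /(filippov_half hpR hpL)[h _]].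
  by exists (Re v), (Im v).
- by move=> s t; apply: absolutely_continuousN.
- by move=> s t; apply: absolutely_continuousN.
- apply: ae_lebesgueS ode => t [v [dx dy] /(filippov_half hpR hpL)[_ h]].
  by exists (- Re v), (- Im v); split => //; exact: is_derive1N.
Qed.

Let rho := expR (a * (pi / b)).
Let sigma := expR (c * (pi / d)).

(** Measured in the rotated plane: the half turn from [X - i] ends at [- upper_image X + i]. *)
Definition upper_image X := x1 + rho * (X + x1).
Definition return_map X := x0 + sigma * (upper_image X + x0).

(** For general [X] this is the trace of one turn from [X - i]; it closes up when [X] is the fixed
    point of the return map. *)
Definition cycle X : set R[i] := [set z |
  half_arc a b x1 1 (11 / 20) X (Re z) (Im z) \/
  half_arc c d x0 (-1) 1 (upper_image X) (- Re z) (- Im z)].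

Let rho1 : 0 < rho < 1.
Proof.
rewrite expR_gt0 expR_lt1 nmulr_rlt0 ?divr_gt0 ?pi_gt0 ?(hp_be hpR)//.
exact: hp_al hpR.
Qed.

Let sigma1 : 0 < sigma < 1.
Proof.
rewrite expR_gt0 expR_lt1 nmulr_rlt0 ?divr_gt0 ?pi_gt0 ?(hp_be hpL)//.
exact: hp_al hpL.
Qed.

Let x00 : 0 < x0 := hp_k hpL.
Let x10 : 0 < x1 := hp_k hpR.

Lemma upper_image_gt X : x0 < X -> x1 < upper_image X.
Proof.
move=> xX; rewrite ltrDl mulr_gt0//; first by case/andP: rho1.
by rewrite addr_gt0// (lt_trans x00).
Qed.

Lemma return_map_gt X : x0 < X -> x0 < return_map X.
Proof.
move=> /upper_image_gt xX; rewrite ltrDl mulr_gt0//; first by case/andP: sigma1.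
by rewrite addr_gt0// (lt_trans x10).
Qed.

Definition fixpt := (x0 + sigma * (x1 + rho * x1 + x0)) / (1 - sigma * rho).

Let sr1 : 0 < sigma * rho < 1.
Proof.
case/andP: rho1 => r0 r1; case/andP: sigma1 => s0 s1.
by rewrite mulr_gt0//= mulr_ilt1// ltW.
Qed.

Lemma return_map_fixpt : return_map fixpt = fixpt.
Proof.
have h : 1 - sigma * rho != 0 by case/andP: sr1 => _ h; rewrite subr_eq0 gt_eqF.
by rewrite /return_map /upper_image /fixpt; field.
Qed.

Lemma fixpt_gt : x0 < fixpt.
Proof.
have /andP[r0 r1] := rho1; have /andP[s0 s1] := sigma1; have /andP[q0 q1] := sr1.
have x00' := x00; have x10' := x10.
rewrite /fixpt ltr_pdivlMr ?subr_gt0// mulrBr mulr1.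
apply: (@lt_le_trans _ _ x0); first by rewrite gtrDl oppr_lt0 mulr_gt0.
by rewrite lerDl mulr_ge0 ?(ltW s0)// addr_ge0 ?(ltW x00')// addr_ge0 ?(ltW x10')// mulr_ge0 ?ltW.
Qed.

Lemma return_mapB X : return_map X - fixpt = sigma * rho * (X - fixpt).
Proof.
rewrite -{1}return_map_fixpt; move: fixpt => p.
by rewrite /return_map /upper_image; ring.
Qed.

Lemma return_map_iter X n :
  iter n return_map X - fixpt = (sigma * rho) ^+ n * (X - fixpt).
Proof.
elim: n => [|n IH]; first by rewrite expr0 mul1r.
by rewrite iterS return_mapB IH exprS mulrA.
Qed.

Lemma return_map_cvg X e : 0 < e ->
  exists n, (iter n return_map X - fixpt) ^+ 2 < e.
Proof.
move=> e0; have /andP[q0 q1] := sr1; set q := sigma * rho in q0 q1.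
pose C := (X - fixpt) ^+ 2; have C0 : 0 <= C := sqr_ge0 _.
have e1 : 0 < e / (C + 1) by rewrite divr_gt0// ltr_wpDl.
have : `|q| < 1 by rewrite gtr0_norm.
move=> /cvg_expr/cvgrPdist_lt/(_ _ e1)[N _ /(_ N (leqnn N))] /=.
rewrite sub0r normrN ger0_norm ?exprn_ge0 ?(ltW q0)// => qN.
exists N; rewrite return_map_iter exprMn -/C -/q.
apply: (@le_lt_trans _ _ (q ^+ N * C)).
  rewrite ler_wpM2r// expr2 ger_pMl ?exprn_gt0// exprn_ile1 ?(ltW q0) ?ltW//.
move: qN; rewrite ltr_pdivlMr; last lra.
have : 0 < q ^+ N by rewrite exprn_gt0.
by rewrite mulrDr mulr1; lra.
Qed.

(** * Solutions that meet the basin *)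

Section Solution.
Variables (D : set R[i]) (g : R -> R[i]).
Hypothesis sg : solution D F g.

Let hR := (solution_half sg).1.
Let hL := (solution_half sg).2.

(** The second half is the same half turn for the rotated trajectory, with the two foci
    exchanged. *)
Lemma full_turn t0 : Im (g t0) = -1 -> x0 < Re (g t0) ->
  exists t2, [/\ t0 + pi / b <= t2, g t2 = return_map (Re (g t0)) +i* (-1) &
    forall z, cycle (Re (g t0)) z <-> exists2 t, t0 <= t <= t2 & z = g t].
Proof.
move=> y0 xx; have [t1 [t01 yt1 xt1 A1]] := half_turn hpR hR y0 xx.
have xE : - Re (g t1) = upper_image (Re (g t0)) by rewrite xt1 /upper_image /rho; ring.
have yE : - Im (g t1) = -1 by rewrite yt1.
have xx1 : x1 < - Re (g t1) by rewrite xE; exact: upper_image_gt.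
have [t2 [t12 yt2 xt2 A2]] := half_turn hpL hL yE xx1.
have pb0 : 0 <= pi / b by rewrite divr_ge0 ?pi_ge0// ltW// (hp_be hpR).
have pd0 : 0 <= pi / d by rewrite divr_ge0 ?pi_ge0// ltW// (hp_be hpL).
exists t2; split; first lra.
  apply/eqP; rewrite eq_complex /return_map -xE /sigma /=; apply/andP; split; apply/eqP.
    by rewrite -[LHS]opprK xt2; ring.
  by rewrite -[LHS]opprK yt2.
move=> z; rewrite /cycle /= A1 -xE A2; split.
- case=> -[t tt [zx zy]]; (exists t; first lra).
    by apply/eqP; rewrite eq_complex zx zy !eqxx.
  by apply/eqP; rewrite eq_complex -eqr_opp zx -[X in _ && X]eqr_opp zy !eqxx.
- move=> [t tt ->]; have [tt1|t1t] := leP t t1.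
    by left; exists t => //; lra.
  by right; exists t => //; lra.
Qed.

Lemma iterate_turns t0 n : Im (g t0) = -1 -> x0 < Re (g t0) ->
  exists2 t, t0 <= t & g t = iter n return_map (Re (g t0)) +i* (-1).
Proof.
move=> y0 xx; suff : exists t, [/\ t0 <= t, g t = iter n return_map (Re (g t0)) +i* (-1) &
    x0 < iter n return_map (Re (g t0))] by move=> [t [? ? _]]; exists t.
elim: n => [|n [t [t0t gt xt]]].
  by exists t0; split => //=; rewrite -y0; case: (g t0).
have [||t2 [tt2 gt2 _]] := @full_turn t; rewrite ?gt//.
have pb0 : 0 <= pi / b by rewrite divr_ge0 ?pi_ge0// ltW// (hp_be hpR).
exists t2; rewrite gt2 gt iterS; split => //; first lra.
exact: return_map_gt.
Qed.

(** The last two clauses put no condition on [Im z], which keeps the set open at the points where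
    the cycle crosses the lines; outside the closed strip they add nothing to the first two. *)
Definition basin : set R[i] := [set z | [\/ 1 < Im z, Im z < -1,
  11 / 20 < Re z /\ first_integral 1 x0 1 < first_integral 1 (Re z) (Im z) |
  1 < - Re z /\ first_integral (-1) x1 1 < first_integral (-1) (- Re z) (- Im z)]].

(** From the left, one half turn of the rotated trajectory ends on the section. From the right, the
    half turn ends on the upper line beyond [- x1], and a second one is needed. *)
Lemma basin_reach t0 : basin (g t0) -> exists t, Im (g t) = -1 /\ x0 < Re (g t).
Proof.
move=> Ug.
have left t : 1 < - Im (g t) \/ [/\ 1 < - Re (g t), -1 <= - Im (g t) <= 1 &
    first_integral (-1) x1 1 < first_integral (-1) (- Re (g t)) (- Im (g t))] ->
    exists t, Im (g t) = -1 /\ x0 < Re (g t).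
  move=> /(half_reach hpL hL)[s [ys xs]]; exists s.
  by split; lra.
have right t : 1 < Im (g t) \/ [/\ 11 / 20 < Re (g t), -1 <= Im (g t) <= 1 &
    first_integral 1 x0 1 < first_integral 1 (Re (g t)) (Im (g t))] ->
    exists t, Im (g t) = -1 /\ x0 < Re (g t).
  move=> /(half_reach hpR hR)[s [ys xs]].
  have yE : - Im (g s) = -1 by rewrite ys.
  have xE : x1 < - Re (g s) by lra.
  have [u [_ yu xu _]] := half_turn hpL hL yE xE; exists u.
  have h : 0 < sigma * (- Re (g s) + x0).
    by have /andP[s0 _] := sigma1; rewrite mulr_gt0// addr_gt0// (lt_trans x10).
  by rewrite /sigma in h; split; lra.
have [y1|y1] := ltP 1 (Im (g t0)); first by apply: (right t0); left.
have [y2|y2] := ltP (Im (g t0)) (-1); first by apply: (left t0); left; lra.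
case: Ug => [h|h|[h1 h2]|[h1 h2]]; try (exfalso; lra).
  by apply: (right t0); right; split => //; lra.
by apply: (left t0); right; split => //; lra.
Qed.

Variable T : R.
Hypotheses (T0 : 0 < T) (gT : forall t, g (t + T) = g t).

Lemma periodic_nat t n : g (t + n%:R * T) = g t.
Proof.
elim: n => [|n IH]; first by rewrite mul0r addr0.
by rewrite -natr1 mulrDl mul1r addrA gT.
Qed.

Lemma periodic_shift t r : exists2 s, r <= s <= r + T & g s = g t.
Proof.
pose n := Num.floor ((t - r) / T); have := periodize_rem (t - r) T0; rewrite -/n => h.
exists (t - T * n%:~R); first lra.
case: n h => n h; first by rewrite -(periodic_nat (t - T * n%:~R) n); congr g; ring.
rewrite -[RHS](periodic_nat _ n.+1); congr g; rewrite NegzE mulrNz; ring.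
Qed.

Lemma periodic_solution_range t0 : basin (g t0) -> range g = cycle fixpt.
Proof.
move=> /basin_reach[{}t0 [y0 xx]].
have [_ acx acy _] := sg.
have cx : continuous (fun t => Re (g t)) := locally_ac_continuous acx.
have cy : continuous (fun t => Im (g t)) := locally_ac_continuous acy.
(* Minus the squared distance to the fixed point on the section. It attains a maximum over one
   period, and the iterates of the return map force this maximum to be 0. *)
pose phi t := - ((Re (g t) - fixpt) ^+ 2 + (Im (g t) + 1) ^+ 2).
have cphi t : {for t, continuous phi}.
  apply: contN; apply: contD; apply: contX2; apply: contD.
  - exact: cx.
  - exact: cont_cst.
  - exact: cy.
  - exact: cont_cst.
have [|p p0T pmax] := @EVT_max R phi 0 T (ltW T0).
  by apply: continuous_subspaceT.
have pmax' t : phi t <= phi p.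
  have [s] := periodic_shift t 0; rewrite add0r => s0T gs.
  have -> : phi t = phi s by rewrite /phi gs.
  by apply: pmax; rewrite in_itv.
have gp : g p = fixpt +i* (-1).
  have phi0 : - phi p <= 0.
    rewrite leNgt; apply/negP => p0.
    have [n ltn] := return_map_cvg (Re (g t0)) p0.
    have [t _ gt] := iterate_turns n y0 xx.
    have := pmax' t; rewrite {1}/phi gt /= addNr expr0n /= addr0 => h.
    by have := lt_le_trans ltn (ltac:(lra) : - phi p <= (iter n return_map (Re (g t0)) - fixpt) ^+ 2); rewrite ltxx.
  move: phi0; rewrite /phi opprK => phi0.
  have s1 := sqr_ge0 (Re (g p) - fixpt); have s2 := sqr_ge0 (Im (g p) + 1).
  have /eqP : (Re (g p) - fixpt) ^+ 2 = 0 by lra.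
  have /eqP : (Im (g p) + 1) ^+ 2 = 0 by lra.
  rewrite !sqrf_eq0 subr_eq0 addr_eq0 => /eqP yp /eqP xp.
  by rewrite -xp -yp; case: (g p).
have pb0 : 0 < pi / b by rewrite divr_gt0 ?pi_gt0// (hp_be hpR).
(* From [p] on, every turn starts again at the fixed point and lasts at least [pi / b], so the whole
   future of [p] lies on the cycle; periodicity brings any time into that future. *)
have turns n : exists t, [/\ p + n%:R * (pi / b) <= t, g t = fixpt +i* (-1) &
    forall s, p <= s <= t -> cycle fixpt (g s)].
  elim: n => [|n [t [pt gt gs]]].
    exists p; rewrite mul0r addr0; split => // s sp.
    have [||t2 [t02 _ A]] := @full_turn p; rewrite ?gp//=; first exact: fixpt_gt.
    by move: A; rewrite gp /= => ->; exists s => //; lra.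
  have [||t2 [t02 gt2 A]] := @full_turn t; rewrite ?gt//=; first exact: fixpt_gt.
  exists t2; rewrite gt2 gt /= return_map_fixpt -natr1 mulrDl mul1r; split => //; first lra.
  move=> s sp; have [st|ts] := leP s t; first by apply: gs; lra.
  by move: A; rewrite gt /= => ->; exists s => //; lra.
apply/seteqP; split => [_ [t _ <-]|z].
  have [s /andP[ps _] <-] := periodic_shift t p.
  pose n := Num.truncn ((s - p) / (pi / b)).
  have [u [pu _ us]] := turns n.+1; apply: us; rewrite ps/=; apply: le_trans pu.
  rewrite -lerBlDl -ler_pdivrMr//; apply: ltW; exact/real_truncnS_gt/num_real.
have [||t2 [t02 _ A]] := @full_turn p; rewrite ?gp//=; first exact: fixpt_gt.
by move: A; rewrite gp /= => A /A[t _ ->]; exists t.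
Qed.

End Solution.
End Dynamics.

(** * The periodic solution *)

(** The excluded times are the translates of the points of [B] by multiples of [p], a countable
    set. *)
Lemma ae_periodic_exceptions {R : realType} (p : R) (B : seq R) :
  {ae @lebesgue_measure R, forall t, t - p * (Num.floor (t / p))%:~R \notin B}.
Proof.
pose f (q : nat * int) : R := nth 0 B q.1 + p * q.2%:~R.
have cf : countable (range f).
  by apply: sub_countable (card_image_le _ _) _; exact: countableP.
exists (range f); split.
- exact: countable_measurable.
- exact: countable_lebesgue_measure0.
- move=> t /= /negP; rewrite negbK => tB.
  exists (index (t - p * (Num.floor (t / p))%:~R) B, Num.floor (t / p)) => //.
  by rewrite /f /= nth_index// subrK.
Qed.

(** * The periodic solution and its neighbourhood *)

Section Existence.
Context {R : realType}.
Variables (a b c d x0 x1 : R).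
Local Notation Re := complex.Re.
Local Notation Im := complex.Im.

Local Notation F := (filippov (fun z : R[i] => (a +i* b) * (z - 'i%C + x1%:C))
  (fun z : R[i] => 'i%C * z ^+ 2 / (1 + z))
  (fun z : R[i] => (c +i* d) * (z + 'i%C - x0%:C))).
Local Notation D := [set z : R[i] | 1 + z != 0].

Hypotheses (hpR : half_params a b x1 c d x0 1 (11 / 20) 200^-1)
  (hpL : half_params c d x0 a b x1 (-1) 1 2).

Local Notation fixpt := (fixpt a b c d x0 x1).
Local Notation basin := (basin x0 x1).

Lemma periodic_solution_exists : exists (g : R -> R[i]) (T : R),
  [/\ 0 < T, solution D F g, forall t, g (t + T) = g t,
      g 0 = fixpt +i* (-1) & exists t, Im (g t) = 1].
Proof.
have fp := fixpt_gt hpR hpL; have up := upper_image_gt hpR hpL fp.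
have [p1 [T1 [K1 [xa [ya A]]]]] := half_path_exists hpR fp.
have [p2 [T2 [K2 [xb [yb B]]]]] := half_path_exists hpL up.
have /andP[p10 p1T] := path_switch A; have /andP[p20 p2T] := path_switch B.
have T10 := lt_trans p10 p1T; have T20 := lt_trans p20 p2T.
pose T := T1 + T2; have T0 : 0 < T by rewrite addr_gt0.
pose xg := glue T1 xa (fun t => - xb t); pose yg := glue T1 ya (fun t => - yb t).
have jx : xa T1 = - xb 0 by rewrite (path_xT A) (path_x0 B) /upper_image; ring.
have jy : ya T1 = - yb 0 by rewrite (path_yT A) (path_y0 B) opprK.
have xg0 : xg 0 = fixpt by rewrite /xg glue_left ?(ltW T10)// (path_x0 A).
have yg0 : yg 0 = -1 by rewrite /yg glue_left ?(ltW T10)// (path_y0 A).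
have xgT : xg T = xg 0.
  rewrite xg0 /xg glue_right ?(ltW T20)// (path_xT B) -[RHS](return_map_fixpt hpR hpL).
  by rewrite /return_map; ring.
have ygT : yg T = yg 0 by rewrite yg0 /yg glue_right ?(ltW T20)// (path_yT B).
pose K := K1 + K2.
have K0 : 0 <= K by rewrite addr_ge0 ?(path_lip0 A) ?(path_lip0 B).
have KA s t : s <= t -> K1 * (t - s) <= K * (t - s).
  by move=> st; rewrite ler_wpM2r ?subr_ge0// lerDl (path_lip0 B).
have KB s t : s <= t -> K2 * (t - s) <= K * (t - s).
  by move=> st; rewrite ler_wpM2r ?subr_ge0// lerDr (path_lip0 A).
have xlip s t : 0 <= s -> s <= t -> t <= T -> `|xg t - xg s| <= K * (t - s).
  apply: glue_lipschitz => //; first exact: ltW.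
    move=> u w u0 uw wT; apply: le_trans (KA _ _ uw).
    by case: (path_lip A u0 uw wT).
  move=> u w u0 uw wT; apply: le_trans (KB _ _ uw).
  by rewrite -opprD normrN; case: (path_lip B u0 uw wT).
have ylip s t : 0 <= s -> s <= t -> t <= T -> `|yg t - yg s| <= K * (t - s).
  apply: glue_lipschitz => //; first exact: ltW.
    move=> u w u0 uw wT; apply: le_trans (KA _ _ uw).
    by case: (path_lip A u0 uw wT).
  move=> u w u0 uw wT; apply: le_trans (KB _ _ uw).
  by rewrite -opprD normrN; case: (path_lip B u0 uw wT).
pose g t := periodize T xg t +i* periodize T yg t.
exists g, T; split => //.
- split.
  + move=> t /=; rewrite /g /periodize; have := periodize_rem t T0.
    set s := t - _ => /andP[s0 sT].
    (* The path avoids the pole -1: inside the strip its real part exceeds 11/20 on the first half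
       and is below -1 on the second, and elsewhere the imaginary part is nonzero. *)
    rewrite eq_complex /= negb_and.
    have [sT1|T1s] := leP s T1.
      rewrite /xg /yg !glue_left//.
      have [|[ex y1]|y1] := path_in A (t := s); first by rewrite s0.
        by apply/orP; left; rewrite gt_eqF//; lra.
      by apply/orP; right; rewrite gt_eqF//; lra.
    have sE : s = T1 + (s - T1) by ring.
    rewrite sE /xg /yg !glue_right//; try lra.
    have [|[ex y1]|y1] := path_in B (t := s - T1); first by rewrite /T in sT; lra.
      by apply/orP; left; rewrite lt_eqF//; lra.
    by apply/orP; right; rewrite lt_eqF//; lra.
  + move=> s t; apply: (absolutely_continuous_lipschitz K0) => u w _ uw _.
    exact: periodize_lipschitz uw.
  + move=> s t; apply: (absolutely_continuous_lipschitz K0) => u w _ uw _.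
    exact: periodize_lipschitz uw.
  + have := ae_periodic_exceptions T [:: 0; p1; T1; T1 + p2].
    apply: ae_lebesgueS => t.
    set n := Num.floor _; set s := t - _; rewrite !inE !negb_or => /and4P[s0 sp1 sT1 sp2].
    have /andP[s0' sT] : 0 <= s < T := periodize_rem t T0.
    have sin : 0 < s < T by rewrite sT lt_neqAle eq_sym s0 s0'.
    have gE : g t = xg s +i* yg s by [].
    have /andP[spos _] := sin.
    have [ltT|gtT|eqT] := ltgtP s T1; last by rewrite eqT eqxx in sT1.
      have [|vx [vy [dx dy av]]] := path_vel A _ sp1; first by rewrite spos.
      exists (vx +i* vy).
        split; apply: (is_derive_periodize (n := n)) => //; exact: is_derive_glue_left.
      apply: arc_filippov_right; rewrite gE /= /xg /yg !glue_left ?(ltW ltT)//.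
    have sp2' : s - T1 != p2 by rewrite subr_eq addrC.
    have [|vx [vy [dx dy av]]] := path_vel B _ sp2'; first by rewrite /T in sT; lra.
    exists ((- vx) +i* (- vy)).
      split; apply: (is_derive_periodize (n := n)) => //;
      by apply: is_derive_glue_right => //; exact: is_derive1N.
    have sE : s = T1 + (s - T1) by ring.
    apply: arc_filippov_left; rewrite gE /= {1 2}sE /xg /yg !glue_right//; try lra.
    by rewrite !opprK.
- by move=> t; rewrite /g !periodizeD.
- by rewrite /g !periodize_in ?xg0 ?yg0// lexx.
- exists T1; rewrite /g /= periodize_in; last by rewrite /T; lra.
  by rewrite /yg glue_left// (path_yT A).
Qed.

(** The end point of each arc lies on a line, but it starts the other half turn beyond its
    threshold, and so above the critical level there; for the second arc this uses the fixed point
    equation. *)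
Lemma cycle_basin : cycle a b c d x0 x1 fixpt `<=` basin.
Proof.
have fp := fixpt_gt hpR hpL; have up := upper_image_gt hpR hpL fp.
have y11 : -1 <= (1 : R) <= 1 by lra.
move=> z [] h; rewrite /basin /=.
- have [h1|[h1 h2 h3]|[h1 h2]] := half_arc_region hpR fp h; first exact: Or41.
    exact: Or43.
  apply: Or44; have -> : - Re z = upper_image a b x1 fixpt by rewrite h1 /upper_image; ring.
  split; first exact: lt_trans (hp_k' hpL) up.
  rewrite h2 first_integral_even.
  exact: (first_integral_increasing hpL (ltW (hp_k' hpL)) up y11).
- have [h1|[h1 h2 h3]|[h1 h2]] := half_arc_region hpL up h.
  + by apply: Or42; lra.
  + exact: Or44.
  have -> : z = fixpt +i* (-1).
    apply/eqP; rewrite eq_complex -eqr_opp h1 -[X in _ && X]eqr_opp h2 /= opprK eqxx andbT.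
    by rewrite -[in eqbRHS](return_map_fixpt hpR hpL) /return_map; apply/eqP; ring.
  apply: Or43 => /=; rewrite first_integral_even; split.
    exact: lt_trans (hp_k' hpR) fp.
  exact: (first_integral_increasing hpR (ltW (hp_k' hpR)) fp y11).
Qed.

Let open_strip (eps sg e h : R) : -1 <= eps <= 1 -> 2^-1 <= e -> sg ^+ 2 = 1 ->
  open [set p : R * R | e < sg * p.1 /\ h < first_integral eps (sg * p.1) (sg * p.2)].
Proof.
move=> eps1 e2 sg1; rewrite openE => p [/= ep hp].
(* The divisor 12 is the Lipschitz constant 6 counted once for each coordinate. *)
pose r := Num.min (sg * p.1 - e) ((first_integral eps (sg * p.1) (sg * p.2) - h) / 12).
have r0 : 0 < r by rewrite lt_min subr_gt0 ep divr_gt0// subr_gt0.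
have sgn : `|sg| = 1.
  by apply/eqP; rewrite -sqrp_eq1// -normrX sg1 normr1.
have nrm (u v : R) : `|sg * u - sg * v| = `|u - v| by rewrite -mulrBr normrM sgn mul1r.
apply/nbhs_ballP; exists r => // q [/=]; rewrite /ball /= -nrm -[X in _ -> X < _ -> _]nrm.
have : r <= sg * p.1 - e by rewrite ge_min lexx.
have : r <= (first_integral eps (sg * p.1) (sg * p.2) - h) / 12 by rewrite ge_min lexx orbT.
move=> r1 r2 q1 q2.
have eq1 : e < sg * q.1 by move: q1; rewrite ltr_norml; lra.
split => //.
have ep' : 2^-1 <= sg * p.1 by lra.
have eq' : 2^-1 <= sg * q.1 by lra.
have := first_integral_lipschitz eps1 (sg * p.2) (sg * q.2) ep' eq'.
rewrite ler_norml [`|_ - sg * p.1|]distrC [`|_ - sg * p.2|]distrC; lra.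
Qed.

Lemma open_basin : open_plane basin.
Proof.
pose s1 : R := 1; rewrite /open_plane.
have -> : [set p : R * R | basin (p.1 +i* p.2)] =
    (([set p | 1 < p.2] `|` [set p | p.2 < -1]) `|`
    ([set p | 11 / 20 < 1 * p.1 /\ first_integral 1 x0 1 < first_integral 1 (1 * p.1) (1 * p.2)] `|`
     [set p | 1 < -1 * p.1 /\ first_integral (-1) x1 1 < first_integral (-1) (-1 * p.1) (-1 * p.2)])).
  apply/seteqP; split => p; rewrite /basin /= !mul1r !mulN1r.
    by case=> h; [left; left|left; right|right; left|right; right].
  by case=> [[h|h]|[h|h]]; [exact: Or41|exact: Or42|exact: Or43|exact: Or44].
apply: openU; apply: openU.
- apply: (@open_comp _ _ (fun p : R * R => p.2) [set y | 1 < y]).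
    by move=> p _; exact: cvg_snd.
  exact: open_gt.
- apply: (@open_comp _ _ (fun p : R * R => p.2) [set y | y < -1]).
    by move=> p _; exact: cvg_snd.
  exact: open_lt.
- by apply: open_strip; lra.
- by apply: open_strip; [lra|lra|rewrite sqrrN expr1n].
Qed.

End Existence.

Theorem proposition5 (R : realType) (a b c d x0 x1 : R)
    (ha : a < 0) (hc : c < 0) (hb : 0 < b) (hd : 0 < d)
    (hx0 : 55 / 100 < x0) (hx1 : 136 / 100 < x1) :
  exists G : set R[i],
    limit_cycle [set z | 1 + z != 0]
      (filippov (fun z => (a +i* b) * (z - 'i%C + x1%:C))
                (fun z => 'i%C * z ^+ 2 / (1 + z))
                (fun z => (c +i* d) * (z + 'i%C - x0%:C)))
      G.
Proof.
have hpR := half_params_right ha hc hb hd hx0 hx1.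
have hpL := half_params_left ha hc hb hd hx0 hx1.
exists (cycle a b c d x0 x1 (fixpt a b c d x0 x1)).
(* It serves twice: to identify the orbit of the constructed solution with [cycle], and to show that
   every periodic orbit meeting the basin is this same set. *)
have uniq := periodic_solution_range hpR hpL.
have [g [T [T0 sg gT g0 [t1 gt1]]]] := periodic_solution_exists hpR hpL.
have g0R : range g (g 0) by exists 0.
have in_basin : basin x0 x1 (g 0).
  rewrite g0; apply: Or43 => /=; have fp := fixpt_gt hpR hpL; split.
    exact: lt_trans (hp_k' hpR) fp.
  rewrite first_integral_even.
  by apply: (first_integral_increasing hpR (ltW (hp_k' hpR)) fp); lra.
split.
  exists g; split => //.
  - by exists T.
  - by exists t1, 0 => /(congr1 (@complex.Im R)); rewrite gt1 g0 /=; lra.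
  - by rewrite (uniq _ _ sg _ T0 gT _ in_basin).
exists (basin x0 x1); split.
- exact: open_basin.
- exact: cycle_basin.
- move=> G' [g' [sg' [T' T'0 gT'] _ ->]] [z [[t _ <-] zU]].
  exact: (uniq _ _ sg' _ T'0 gT' _ zU).
Qed.
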